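(* Let $\ell_1\in H^1(\Omega_f\mathbb R^3\setminus\Sigma,\mathbb Z_2)$ and $\ell_2\in H^2(\Omega_f\mathbb R^3\setminus\Sigma,\mathbb Z_2)$ be the generators of the groups of first-order $\mathbb Z_2$-cohomology classes of the space of knots in $\mathbb R^3$ in dimensions $1$ and $2$: $\ell_1$ is the linking number (mod 2) with the set of maps $\phi:S^1\to\mathbb R^3$ such that $\phi(x)=\phi(x+\pi)$ for some $x\in S^1$, and $\ell_2$ is the linking number (mod 2) with the set of maps $\phi$ such that $\phi(0)=\phi(\pi)$. Then both $\ell_1$ and $\ell_2$ are non-trivial already in restriction to the component of unknots of $\Omega_f\mathbb R^3\setminus\Sigma$. Moreover, $\ell_1$ takes non-zero value on the 1-cycle in the space of unknots obtained by rotating the standard embedded circle in $\mathbb R^3$ by all angles $\alpha\in[0,2\pi]$ around any of its diameters.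
   Context: $\Omega_f\mathbb R^3$ is the space of smooth maps $S^1=\mathbb R/2\pi\mathbb Z\to\mathbb R^3$; $\Sigma\subset\Omega_f\mathbb R^3$ is the set of maps having self-intersections or singular points (zero derivative), so that knots are the elements of $\Omega_f\mathbb R^3\setminus\Sigma$. The linking number (mod 2) with a subvariety $V\subset\Sigma$ of codimension $c$ in $\Omega_f\mathbb R^3$ is the $(c-1)$-dimensional cohomology class whose value on a $(c-1)$-cycle in $\Omega_f\mathbb R^3\setminus\Sigma$ is the mod 2 intersection number with $V$ of a generic chain in $\Omega_f\mathbb R^3$ spanning this cycle. The two varieties above have codimension $2$ and $3$ respectively. *)

(* Defs.v *)
(* MathComp-Analysis over an arbitrary R : realType; singular chains are the
   finitely supported formal sums {freeg K / G} of multinomials. *)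
From HB Require Import structures.
From mathcomp Require Export all_boot all_order all_algebra.
From mathcomp Require Export all_classical all_reals all_analysis.
From mathcomp Require Export finmap freeg.
From mathcomp Require Import ring.
Export Order.TTheory GRing.Theory Num.Theory.
Export numFieldNormedType.Exports.

Set Implicit Arguments.
Unset Strict Implicit.
Unset Printing Implicit Defensive.

Local Open Scope classical_set_scope.
Local Open Scope ring_scope.

Section singular.
Variable R : realType.

Definition std_simplex (n : nat) : set 'rV[R]_n.+1 :=
  [set t | (forall i, 0 <= t 0 i) /\ \sum_i t 0 i = 1].

Arguments std_simplex : clear implicits.

Definition face_row (n : nat) (i : 'I_n.+2) (t : 'rV[R]_n.+1) : 'rV[R]_n.+2 :=
  \row_j (if unlift i j is Some k then t 0 k else 0).

Lemma face_row_simplex (n : nat) (i : 'I_n.+2) (t : std_simplex n) :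
  face_row i (\val t) \in std_simplex n.+1.
Proof.
case: t => t /= /set_mem [t0 t1]; apply/mem_set; split.
  by move=> j; rewrite mxE; case: unliftP => [k _|_] //.
rewrite (bigD1_ord i) //= mxE unlift_none add0r -t1.
by apply: eq_bigr => k _; rewrite mxE liftK.
Qed.

Definition face_incl (n : nat) (i : 'I_n.+2) (t : std_simplex n) :
  std_simplex n.+1 :=
  exist (fun u => u \in std_simplex n.+1) _ (face_row_simplex i t).

Lemma face_incl_continuous (n : nat) (i : 'I_n.+2) :
  continuous (@face_incl n i).
Proof.
have fc (u : 'rV[R]_n.+1) : face_row i v @[v --> u] --> face_row i u.
  apply/(@cvgrPdist_lt _ _ _ (nbhs u) (nbhs_filter u)) => /= e e0.
  have te : nbhs u [set v : 'rV[R]_n.+1 | forall l, `|u 0 l - v 0 l| < e].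
    exists (fun k l => ball (u k l) e) => [k l|v uv l]; last exact: uv.
    exact: nbhsx_ballx.
  apply: filterS te => v tv.
  rewrite [ltLHS]/Num.Def.normr/= mx_normrE; apply/bigmax_ltP; split => // -[k j] _ /=.
  by rewrite !mxE; case: unlift => [l|]; [exact: tv|rewrite subrr normr0].
apply: continuous_comp_initial => t.
have -> : set_val \o @face_incl n i = @face_row n i \o set_val.
  by apply/funext => u; rewrite /= !set_valE.
by apply: continuous_comp; [exact: initial_continuous|exact: fc].
Qed.

Variable X : topologicalType.

(* Singular chains of X with coefficients in Z/2, on the affine simplices
   std_simplex n of R^(n+1). *)
Definition simplex (n : nat) := continuousType (std_simplex n) X.

Definition face (n : nat) (i : 'I_n.+2) (s : simplex n.+1) : simplex n :=
  (s \o mkcts (@face_incl_continuous n i) : continuousType _ _).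

Definition chain (n : nat) := {freeg (simplex n) / 'F_2}.

Definition boundary (n : nat) : chain n.+1 -> chain n :=
  fglift (fun s => \sum_(i < n.+2) << face i s >>).

Definition simplex_in (A : set X) (n : nat) (s : simplex n) :=
  forall t, A (s t).

Definition chain_in (A : set X) (n : nat) (c : chain n) :=
  forall s, s \in dom c -> simplex_in A s.

Definition cycle_in (A : set X) (n : nat) (c : chain n.+1) :=
  chain_in A c /\ boundary c = 0.

(* A cochain of a subspace A is the restriction to the simplices lying in A
   of a cochain of X; classes in H^n(A, Z/2) are represented by cochains that
   are cocycles on A, and the restriction of a class from A to B `<=` A is
   represented by the same cochain. *)
Definition cochain (n : nat) := simplex n -> 'F_2.

Definition eval (n : nat) (f : cochain n) (c : chain n) : 'F_2 :=
  fglift (f : simplex n -> ('F_2)^o) c.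

Definition cocycle_on (A : set X) (n : nat) (f : cochain n) :=
  forall s : simplex n.+1, simplex_in A s -> eval f (boundary << s >>) = 0.

Definition coboundary_on (A : set X) (n : nat) (f : cochain n.+1) :=
  exists g : cochain n, forall s : simplex n.+1,
    simplex_in A s -> f s = eval g (boundary << s >>).

End singular.

Arguments std_simplex : clear implicits.

Section loops.
Variable R : realType.
Local Notation E3 := 'rV[R]_3.

(* Maps S^1 = R / 2 pi Z -> R^3 are encoded as 2 pi-periodic maps R -> R^3. *)
Record loop := Loop {
  loop_fun :> R -> E3;
  loop_periodic : periodic loop_fun (pi *+ 2);
  loop_smooth : forall n x, derivable loop_fun^`(n)%classic x 1 }.

HB.instance Definition _ := gen_eqMixin loop.
HB.instance Definition _ := gen_choiceMixin loop.

(* The C^oo topology: uniform convergence of all derivatives. *)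
Definition loop_jet (phi : loop) : {ptws nat -> {uniform R -> E3}} :=
  fun n => phi^`(n)%classic.

HB.instance Definition _ :=
  Topological.copy loop (initial_topology loop_jet).

Definition discriminant : set loop :=
  [set phi | (exists x y : R, phi x = phi y /\
                ~ (exists k : int, y - x = k%:~R * (pi *+ 2)))
             \/ (exists x : R, phi^`()%classic x = 0)].

Definition knots : set loop := ~` discriminant.

Definition antipodal_variety : set loop :=
  [set phi | exists x : R, phi x = phi (x + pi)].

Definition base_antipodal_variety : set loop :=
  [set phi | phi 0 = phi pi].

(* F is a map on the ambient space of the simplex that extends the family s
   of loops, and is C^1 near {t} x S^1. *)
Definition C1_family (n : nat) (s : simplex R loop n) (t : std_simplex R n)
    (F : 'rV[R]_n.+1 * R -> E3) :=
  (forall (u : std_simplex R n) (x : R), F (\val u, x) = s u x) /\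
  forall x : R, \forall p \near (\val t, x),
    differentiable F p /\ forall v, {for p, continuous ('D_v F)}.

Definition tangent (n : nat) (v : 'rV[R]_n.+1) := \sum_i v 0 i = 0.

(* At s t = phi lying in antipodal_variety, this asks that the pair
   {x, x + pi} glued by phi is unique, so that phi is a simple point of the
   variety, and that the map (u, y) |-> s u y - s u (y + pi) is submersive at
   (t, x); this is transversality to the incidence variety
   {(phi, x) | phi x = phi (x + pi)}, which near such a point projects
   isomorphically to the variety. *)
Definition antipodal_transverse (n : nat) (s : simplex R loop n)
    (t : std_simplex R n) :=
  (forall x y : R, s t x = s t (x + pi) -> s t y = s t (y + pi) ->
     exists k : int, y - x = k%:~R * pi) /\
  exists F, C1_family s t F /\
    forall x : R, s t x = s t (x + pi) -> forall w : E3,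
      exists v (a : R), tangent v /\
        'd (fun p => F p - F (p.1, p.2 + pi)) (\val t, x) (v, a) = w.

Definition base_antipodal_transverse (n : nat) (s : simplex R loop n)
    (t : std_simplex R n) :=
  exists F, C1_family s t F /\ forall w : E3,
    exists v, tangent v /\
      'd (fun u => F (u, 0) - F (u, pi)) (\val t) v = w.

(* For a chain of dimension codim V: its proper faces miss V, so that the
   intersections lie in the interior of the simplices, and are transverse. *)
Definition generic_chain (V : set loop)
    (transverse : forall n, simplex R loop n -> std_simplex R n -> Prop)
    (n : nat) (c : chain R loop n) :=
  forall s, s \in dom c ->
    finite_set (s @^-1` V) /\
    forall t, V (s t) -> (forall i, 0 < \val t 0 i) /\ transverse n s t.

Definition intersection_number (V : set loop) (n : nat)
    (c : chain R loop n) : 'F_2 :=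
  eval (fun s => #|` fset_set (s @^-1` V)|%:R) c.

(* The class of f in H^n(knots) is the linking number with V, a variety of
   codimension n.+1 in the space of loops. *)
Definition is_linking_class (V : set loop)
    (transverse : forall n, simplex R loop n -> std_simplex R n -> Prop)
    (n : nat) (f : cochain R loop n.+1) :=
  cocycle_on knots f /\
  forall (z : chain R loop n.+1) (c : chain R loop n.+2),
    cycle_in knots z -> boundary c = z -> generic_chain V transverse c ->
    eval f z = intersection_number V c.

Definition vec3 (a b c : R) : E3 := \row_i [:: a; b; c]`_i.

Lemma std_circle_periodic :
  periodic (fun x => vec3 (cos x) (sin x) 0) (pi *+ 2).
Proof. by move=> x; rewrite cosD2pi sinD2pi. Qed.

Lemma is_derive_trig (a b : E3) (x : R) :
  is_derive x 1 (fun x => cos x *: a + sin x *: b) (cos x *: b + sin x *: - a).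
Proof.
have ent i j : is_derive x 1 (fun x => (cos x *: a + sin x *: b) i j)
    ((cos x *: b + sin x *: - a) i j).
  have -> : (fun x => (cos x *: a + sin x *: b) i j) =
      a i j \*: (cos : R -> R) + b i j \*: (sin : R -> R).
    apply/funext => y; rewrite !mxE mulrC [X in _ + X]mulrC; exact: erefl.
  apply: is_derive_eq; rewrite !mxE /GRing.scale/=; ring.
have d : derivable (fun x => cos x *: a + sin x *: b) x 1.
  by apply/derivable_mxP => i j; case: (ent i j).
apply: DeriveDef => //; rewrite derive_mx//; apply/matrixP => i j.
by rewrite !mxE; have := @derive_val _ _ _ _ _ _ _ (ent i j); rewrite !mxE.
Qed.

Lemma std_circle_derive1n n : exists a b : E3,
  (fun x => vec3 (cos x) (sin x) 0)^`(n)%classic =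
  (fun x => cos x *: a + sin x *: b).
Proof.
elim: n => [|n [a [b ih]]].
  exists (vec3 1 0 0), (vec3 0 1 0); apply/funext => x; apply/rowP => i.
  rewrite derive1n0 !mxE; case: i => -[|[|[|//]]] /= _;
    by rewrite !(mulr1, mulr0, addr0, add0r).
exists b, (- a); rewrite derive1nS ih; apply/funext => x.
by rewrite derive1E; have [_ ->] := is_derive_trig a b x.
Qed.

Lemma std_circle_smooth n x :
  derivable ((fun x => vec3 (cos x) (sin x) 0)^`(n)%classic) x 1.
Proof.
by have [a [b ->]] := std_circle_derive1n n; have [] := is_derive_trig a b x.
Qed.

Definition std_circle : loop := Loop std_circle_periodic std_circle_smooth.

Definition unknots : set loop := connected_component knots std_circle.

Lemma move_loop_periodic (M : 'M[R]_3) (phi : loop) :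
  periodic (fun x => phi x *m M) (pi *+ 2).
Proof. by move=> x; rewrite loop_periodic. Qed.

Lemma is_derive_mulmxr (M : 'M[R]_3) (f : R -> E3) (x : R) :
  derivable f x 1 -> is_derive x 1 (fun x => f x *m M) ('D_1 f x *m M).
Proof.
move=> df; have ent i j : is_derive x 1 (fun x => (f x *m M) i j)
    (('D_1 f x *m M) i j).
  have -> : (fun x => (f x *m M) i j) =
      \sum_(k < 3) (M k j \*: (fun x => f x i k)).
    apply/funext => y; rewrite !mxE fct_sumE; apply: eq_bigr => k _.
    by rewrite mulrC.
  have dk k : is_derive x 1 (fun x => f x i k) ('D_1 f x i k).
    by rewrite derive_mx// mxE; apply: derivableP; move/derivable_mxP: df; apply.
  apply: is_derive_eq; rewrite !mxE; apply: eq_bigr => k _.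
  by rewrite /GRing.scale/= mulrC.
have d : derivable (fun x => f x *m M) x 1.
  by apply/derivable_mxP => i j; case: (ent i j).
apply: DeriveDef => //; rewrite derive_mx//; apply/matrixP => i j.
by rewrite mxE; have [_ ->] := ent i j.
Qed.

Lemma move_loop_derive1n (M : 'M[R]_3) (phi : loop) n :
  (fun x => phi x *m M)^`(n)%classic = (fun x => phi^`(n)%classic x *m M).
Proof.
elim: n => [|n ih]; first by rewrite derive1n0.
rewrite derive1nS ih; apply/funext => x; rewrite derive1E derive1nS derive1E.
by have [_ ->] := is_derive_mulmxr M (@loop_smooth phi n x).
Qed.

Lemma move_loop_smooth (M : 'M[R]_3) (phi : loop) n x :
  derivable ((fun x => phi x *m M)^`(n)%classic) x 1.
Proof.
rewrite move_loop_derive1n.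
by have [] := is_derive_mulmxr M (@loop_smooth phi n x).
Qed.

Definition move_loop (M : 'M[R]_3) (phi : loop) : loop :=
  Loop (@move_loop_periodic M phi) (@move_loop_smooth M phi).

Definition cross (u v : E3) : E3 :=
  vec3 (u 0 1 * v 0 2%:R - u 0 2%:R * v 0 1)
       (u 0 2%:R * v 0 0 - u 0 0 * v 0 2%:R)
       (u 0 0 * v 0 1 - u 0 1 * v 0 0).

(* Rodrigues' formula, for row vectors: if u is a unit vector, p *m rotation u a
   is the image of p by the rotation of angle a around the axis directed by
   u. *)
Definition rotation (u : E3) (a : R) : 'M[R]_3 :=
  u^T *m u + cos a *: (1%:M - u^T *m u)
  + sin a *: \matrix_i cross u (delta_mx 0 i).

(* The parameter a in [0, 2 pi] is 2 pi times the second barycentric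
   coordinate. *)
Definition rotating_circle_fun (theta : R) (t : std_simplex R 1) : loop :=
  move_loop (rotation (vec3 (cos theta) (sin theta) 0)
                      (pi *+ 2 * \val t 0 1)) std_circle.

Lemma rotating_circle_continuous (theta : R) :
  continuous (rotating_circle_fun theta).
Proof.
set u := vec3 (cos theta) (sin theta) 0.
have rc i j : continuous (fun a : R => rotation u a i j).
  move=> a; rewrite /rotation.
  under eq_fun do rewrite !mxE.
  apply: cvgD; first apply: cvgD; first exact: cvg_cst.
  - by apply: cvgM; [exact: continuous_cos|exact: cvg_cst].
  - by apply: cvgM; [exact: continuous_sin|exact: cvg_cst].
have c0 : continuous (fun v : 'rV[R]_2 => v 0 1) by exact: coord_continuous.
have c1 : continuous (fun v : 'rV[R]_2 => pi *+ 2 * v 0 1).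
  by move=> v; exact: (@continuous_comp _ _ _ _ ( *%R (pi *+ 2)) v (c0 v)
    (@mulrl_continuous _ _ _)).
have c2 : continuous (fun t : std_simplex R 1 => pi *+ 2 * \val t 0 1).
  by move=> t; apply: (@continuous_comp _ _ _ set_val
    (fun v : 'rV[R]_2 => pi *+ 2 * v 0 1));
    [exact: initial_continuous|exact: c1].
have Mcont i j : continuous (fun t : std_simplex R 1 =>
    rotation u (pi *+ 2 * \val t 0 1) i j).
  by move=> t; exact: (@continuous_comp _ _ _ _ (fun a => rotation u a i j) t
    (c2 t) (rc i j _)).
have jc n : continuous (fun t : std_simplex R 1 =>
    (loop_jet (rotating_circle_fun theta t) n : {uniform R -> E3})).
  have [a [b ab]] := std_circle_derive1n n.
  pose C := \sum_k (`|a 0 k| + `|b 0 k|).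
  have C0 : 0 <= C by apply: sumr_ge0 => k _; rewrite addr_ge0.
  move=> t P /uniform_nbhs[E [entE EP]].
  move: entE; rewrite -entourage_ballE => -[e /= e0 eE].
  have d0 : 0 < e / (C + 1) by rewrite divr_gt0// ltr_wpDl.
  have near_t : nbhs t [set v : std_simplex R 1 | forall ij : 'I_3 * 'I_3,
      `|rotation u (pi *+ 2 * \val t 0 1) ij.1 ij.2 -
        rotation u (pi *+ 2 * \val v 0 1) ij.1 ij.2| < e / (C + 1)].
    apply: (@filter_forall _ _ _ (nbhs t) (nbhs_filter t)) => -[i j] /=.
    have /(@cvgrPdist_lt _ _ _ (nbhs t) (nbhs_filter t)) := @Mcont i j t.
    exact.
  apply: filterS near_t => v tv; apply: EP => x _; apply: eE.
  have jE w : loop_jet (rotating_circle_fun theta w) n x =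
      (cos x *: a + sin x *: b) *m rotation u (pi *+ 2 * \val w 0 1).
    transitivity (std_circle^`(n)%classic x *m rotation u (pi *+ 2 * \val w 0 1)).
      exact: (congr1 (@^~ x) (move_loop_derive1n _ std_circle n)).
    by congr (_ *m _); exact: (congr1 (@^~ x) ab).
  rewrite /= !jE; split=> // i j; rewrite (ord1 i).
  rewrite /ball /= [X in X - _]mxE [X in _ - X]mxE -sumrB.
  apply: (@le_lt_trans _ _ (\sum_k (`|a 0 k| + `|b 0 k|) * (e / (C + 1)))).
    apply: (le_trans (ler_norm_sum _ _ _)); apply: ler_sum => k _.
    rewrite -mulrBr normrM; apply: ler_pM => //; last exact: ltW (tv (k, j)).
    have -> : (cos x *: a + sin x *: b) 0 k = cos x * a 0 k + sin x * b 0 k.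
      by rewrite !mxE.
    apply: (le_trans (ler_normD _ _)); rewrite !normrM lerD//.
      by rewrite ler_piMl// ler_norml cos_geN1 cos_le1.
    by rewrite ler_piMl// ler_norml sin_geN1 sin_le1.
  rewrite -mulr_suml -/C mulrCA gtr_pMr// ltr_pdivrMr ?ltr_wpDl//.
  by rewrite mul1r ltrDl.
apply: continuous_comp_initial => /= t.
have FF : Filter ((loop_jet \o rotating_circle_fun theta) @ nbhs t).
  by apply: fmap_filter.
apply/(@cvg_sup _ _ _ _ _ FF) => n.
move=> A [B [[D oD <-] /= Dt DA]].
have jD := @jc n t D (open_nbhs_nbhs (conj oD Dt)).
apply: (@filterS _ (nbhs t) (nbhs_filter t) _ _ _ jD) => v.
exact: DA.
Qed.

Definition rotating_circle (theta : R) : simplex R loop 1 :=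
  mkcts (@rotating_circle_continuous theta).

End loops.

(* Main.v *)
Require Import Defs.
From HB Require Import structures.
From mathcomp Require Import zify ring lra.

Set Implicit Arguments.
Unset Strict Implicit.
Unset Printing Implicit Defensive.

Local Open Scope classical_set_scope.
Local Open Scope ring_scope.

(* All the loops below are ellipses x |-> cos x N + sin x M with N, M in R^3.
   Such a loop is a knot when N and M are independent, and two of its antipodal
   points coincide exactly when cos x N + sin x M = 0.

   Dimension 1: with u the direction of the diameter, v orthogonal to u in the
   plane of the circle and y = x - theta, the rotated circles are
   cos y u + sin y (p v + q e3) with (p, q) on the unit circle. Letting (p, q)
   run over a disk gives a 2-simplex of ellipses whose boundary is the cycle of
   rotations, and which meets the variety only over (p, q) = (0, 0).

   Dimension 2: SO(3) acts freely on the standard circle, and the 2-cycle is,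
   up to scaling and one degenerate face, the projective plane of its rotations
   by pi around an axis n; the map
   phi |-> phi 0 - phi pi sends it to the sphere with degree one mod 2. It is
   filled by a 3-simplex of ellipses on which N has a single, transverse zero;
   two faces of this simplex coincide, and the other two consist of unknots. *)

Local Notation lift := fintype.lift.

(** * Zeros and periods of sine and cosine *)

Section trigonometry.
Variable R : realType.
Implicit Types (x y : R) (k : int).

Lemma sin_intpi k : sin (k%:~R * pi) = 0 :> R.
Proof.
have nat_case n : sin (n%:R * pi) = 0 :> R.
  elim: n => [|n ih]; first by rewrite mul0r sin0.
  by rewrite -natr1 mulrDl mul1r sinDpi ih oppr0.
by case: k => n; [exact: nat_case|rewrite NegzE rmorphN mulNr sinN nat_case oppr0].
Qed.

(** Reducing x modulo pi leaves a remainder in [0, pi), where sine is positive except at 0. *)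
Lemma sin_eq0_intpi x : sin x = 0 -> exists k, x = k%:~R * pi.
Proof.
move=> sx0; have pi0 := pi_gt0 R.
pose k := Num.floor (x / pi); pose r := x - k%:~R * pi.
have sr : sin r = 0 by rewrite sinB sx0 sin_intpi mul0r mulr0 subr0.
have r0 : 0 <= r.
  by rewrite subr_ge0 -ler_pdivlMr// floor_le.
have r1 : r < pi.
  by rewrite ltrBlDr -[X in X + _]mul1r -mulrDl -ltr_pdivrMr// addrC -[X in _ + X]/(1%:~R) -intrD floorD1_gt.
exists k; apply/eqP; rewrite -subr_eq0 -/r.
move: r0; rewrite le_eqVlt eq_sym => /predU1P[->|r0]; first by rewrite eqxx.
have : 0 < sin r by apply: sin_gt0_pi; rewrite r0.
by rewrite sr ltxx.
Qed.

(** With h half the difference, cos 2h = 1, so sin h = 0 and h is a multiple of pi. *)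
Lemma cos_sin_inj x y : cos x = cos y -> sin x = sin y ->
  exists k, y - x = k%:~R * (pi *+ 2).
Proof.
move=> cxy sxy; pose h := (y - x) / 2.
have hE : y - x = h *+ 2 by rewrite /h; field.
have c1 : cos (h *+ 2) = 1.
  by rewrite -hE cosB cxy sxy -!expr2 cos2Dsin2.
have : sin h = 0.
  by apply/eqP; rewrite -sqrf_eq0 sin2cos2; apply/eqP; move: c1; rewrite cos_mulr2n; lra.
move=> /sin_eq0_intpi[k hk]; exists k.
by rewrite hE mulrnAr -hk.
Qed.

Lemma cos_eq0_congr x y : cos x = 0 -> cos y = 0 ->
  exists k, y - x = k%:~R * pi.
Proof. by move=> cx cy; apply: sin_eq0_intpi; rewrite sinB cx cy mulr0 mul0r subr0. Qed.

End trigonometry.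

(** * Ellipses centred at the origin, as loops and as knots *)

Section ellipses.
Variable R : realType.
Implicit Types (A : 'M[R]_3) (x : R).

Definition ellipse A : loop R := move_loop A (std_circle R).

Lemma loop_ext (phi psi : loop R) : phi =1 psi -> phi = psi.
Proof.
case: phi psi => f fp fs [g gp gs] /= /funext fg; subst g.
by congr Loop; exact: Prop_irrelevance.
Qed.

Lemma vec3_mulmx (a b c : R) A :
  vec3 a b c *m A = a *: row 0 A + b *: row 1 A + c *: row 2%:R A.
Proof.
apply/rowP => j; rewrite !mxE !big_ord_recl big_ord0 !mxE /= addr0 addrA.
by congr (_ + _ * _ + _ * _); congr (A _ _); apply/val_inj.
Qed.

Lemma ellipseE A x : ellipse A x = cos x *: row 0 A + sin x *: row 1 A.
Proof. by rewrite /= vec3_mulmx scale0r addr0. Qed.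

Lemma ellipse_derive1 A x :
  (ellipse A)^`()%classic x = cos x *: row 1 A - sin x *: row 0 A.
Proof.
have -> : (ellipse A : R -> _) = fun x => cos x *: row 0 A + sin x *: row 1 A.
  by apply/funext => y; rewrite ellipseE.
by rewrite derive1E; have [_ ->] := is_derive_trig (row 0 A) (row 1 A) x; rewrite scalerN.
Qed.

Lemma ellipseDpi A x : ellipse A (x + pi) = - ellipse A x.
Proof. by rewrite !ellipseE cosDpi sinDpi !scaleNr opprD. Qed.

(** A double point is a linear relation between the two rows, with the differences of cosines and of
    sines as coefficients. A zero of the derivative is one with coefficients - sin x and cos x,
    which never vanish together. *)
Lemma knot_ellipse A :
  (forall a b, a *: row 0 A + b *: row 1 A = 0 -> a = 0 /\ b = 0) ->
  knots (ellipse A).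
Proof.
move=> indep [[x [y [exy]]]|[x]].
  apply; apply: cos_sin_inj; apply/eqP; rewrite -subr_eq0; apply/eqP;
    have := @indep (cos x - cos y) (sin x - sin y); case=> //.
    move: exy; rewrite !ellipseE !scalerBl => /eqP; rewrite -subr_eq0 => /eqP <-.
    by rewrite opprD addrACA.
  move: exy; rewrite !ellipseE !scalerBl => /eqP; rewrite -subr_eq0 => /eqP <-.
  by rewrite opprD addrACA.
rewrite ellipse_derive1 addrC -scaleNr => /indep[/eqP].
rewrite oppr_eq0 => /eqP sx cx; have := cos2Dsin2 x.
by rewrite sx cx expr0n addr0 => /eqP; rewrite eq_sym oner_eq0.
Qed.

(** Each derivative of the ellipse is (cos x a + sin x b) A with fixed a and b. The entries of the
    row vector are bounded independently of x, so closeness of the matrices gives uniform closeness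
    of the derivatives. *)
Lemma ellipse_continuous (T : topologicalType) (A : T -> 'M[R]_3) :
  (forall i j, continuous (fun t => A t i j)) ->
  continuous (fun t => ellipse (A t)).
Proof.
move=> Ac.
have jc n : continuous (fun t => (loop_jet (ellipse (A t)) n : {uniform R -> 'rV[R]_3})).
  have [a [b ab]] := std_circle_derive1n R n.
  pose C := \sum_k (`|a 0 k| + `|b 0 k|).
  have C0 : 0 <= C by apply: sumr_ge0 => k _; rewrite addr_ge0.
  move=> t P /uniform_nbhs[E [entE EP]].
  move: entE; rewrite -entourage_ballE => -[e /= e0 eE].
  (* The added 1 keeps the denominator positive when C = 0 and makes C / (C + 1) < 1 strict. *)
  have d0 : 0 < e / (C + 1) by rewrite divr_gt0// ltr_wpDl.
  have near_t : nbhs t [set v | forall ij : 'I_3 * 'I_3,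
      `|A t ij.1 ij.2 - A v ij.1 ij.2| < e / (C + 1)].
    apply: (@filter_forall _ _ _ (nbhs t) (nbhs_filter t)) => -[i j] /=.
    have /(@cvgrPdist_lt _ _ _ (nbhs t) (nbhs_filter t)) := @Ac i j t.
    exact.
  apply: filterS near_t => v tv; apply: EP => x _; apply: eE.
  have jE w : loop_jet (ellipse (A w)) n x = (cos x *: a + sin x *: b) *m A w.
    rewrite /loop_jet -(congr1 (@^~ x) ab).
    exact: (congr1 (@^~ x) (move_loop_derive1n (A w) (std_circle R) n)).
  rewrite /= !jE; split=> // i j; rewrite (ord1 i).
  rewrite /ball /= [X in X - _]mxE [X in _ - X]mxE -sumrB.
  apply: (@le_lt_trans _ _ (\sum_k (`|a 0 k| + `|b 0 k|) * (e / (C + 1)))).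
    apply: (le_trans (ler_norm_sum _ _ _)); apply: ler_sum => k _.
    rewrite -mulrBr normrM; apply: ler_pM => //; last exact: ltW (tv (k, j)).
    rewrite !mxE; apply: (le_trans (ler_normD _ _)); rewrite !normrM.
    by rewrite lerD// ler_piMl// ?cos_max ?sin_max.
  rewrite -mulr_suml -/C mulrCA gtr_pMr// ltr_pdivrMr ?ltr_wpDl//.
  by rewrite mul1r ltrDl.
(* The topology of loops is initial for the jet map into a product, so each derivative is tested
   separately. *)
apply: continuous_comp_initial => /= t.
have FF : Filter ((@loop_jet R \o (fun t => ellipse (A t))) @ nbhs t).
  by apply: fmap_filter.
apply/(@cvg_sup _ _ _ _ _ FF) => n.
move=> P [B [[D oD <-] /= Dt DP]].
have jD := @jc n t D (open_nbhs_nbhs (conj oD Dt)).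
apply: (@filterS _ (nbhs t) (nbhs_filter t) _ _ _ jD) => v.
exact: DP.
Qed.

(** The image of the interval is a connected set of knots containing both ends. Loops are recognised
    as unknots in this way. *)
Lemma ellipse_path_component (A : R -> 'M[R]_3) (a b : R) :
  (forall i j, continuous (fun t => A t i j)) -> a <= b ->
  (forall t, a <= t <= b -> knots (ellipse (A t))) ->
  connected_component (@knots R) (ellipse (A a)) (ellipse (A b)).
Proof.
move=> Ac ab kA; pose f t := ellipse (A t).
have inI t : `[a, b]%classic t = (a <= t <= b) by rewrite /= in_itv.
apply: (@connected_component_max _ _ (f @` `[a, b])).
- by exists a => //; rewrite inI lexx.
- by move=> _ [t ht <-]; apply: kA; rewrite -inI.
- apply: connected_continuous_connected.
    by apply/connected_intervalP; exact: interval_is_interval.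
  apply: continuous_subspaceT; exact: ellipse_continuous.
- by exists b => //; rewrite inI ab lexx.
Qed.

End ellipses.

(** * Real C^1 functions with explicit directional derivatives *)

Section C1_functions.
Variable R : realType.

(** The derivative is carried as explicit data, so that the rules below compute it together with the
    regularity. *)
Definition is_C1 (V : normedModType R) (f : V -> R) (df : V -> V -> R) :=
  forall p, differentiable f p /\
    forall v, 'D_v f p = df p v /\ {for p, continuous (df^~ v)}.

Section rules.
Variable V : normedModType R.
Implicit Types f g : V -> R.

Lemma is_C1_continuous f df : is_C1 f df -> continuous f.
Proof. by move=> Cf p; apply: differentiable_continuous; case: (Cf p). Qed.

Lemma is_C1_cst c : is_C1 (fun _ : V => c) (fun _ _ => 0).
Proof.
move=> p; split; first exact: differentiable_cst.
by move=> v; split; [exact: derive_cst|exact: cst_continuous].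
Qed.

Lemma is_C1D f df g dg : is_C1 f df -> is_C1 g dg ->
  is_C1 (fun p => f p + g p) (fun p v => df p v + dg p v).
Proof.
move=> Cf Cg p; have [f' df'] := Cf p; have [g' dg'] := Cg p; split.
  exact: differentiableD.
move=> v; have [dfE dfc] := df' v; have [dgE dgc] := dg' v; split; last exact: cvgD.
by rewrite -dfE -dgE -deriveD//; exact: diff_derivable.
Qed.

Lemma is_C1N f df : is_C1 f df -> is_C1 (fun p => - f p) (fun p v => - df p v).
Proof.
move=> Cf p; have [f' df'] := Cf p; split; first exact: differentiableN.
move=> v; have [dfE dfc] := df' v; split; last exact: cvgN.
by rewrite -dfE -deriveN//; exact: diff_derivable.
Qed.

Lemma is_C1M f df g dg : is_C1 f df -> is_C1 g dg ->
  is_C1 (fun p => f p * g p) (fun p v => f p * dg p v + g p * df p v).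
Proof.
move=> Cf Cg p; have [f' df'] := Cf p; have [g' dg'] := Cg p; split.
  exact: differentiableM.
move=> v; have [dfE dfc] := df' v; have [dgE dgc] := dg' v; split.
  by rewrite -dfE -dgE -deriveM//; exact: diff_derivable.
apply: cvgD; apply: cvgM => //; exact: differentiable_continuous.
Qed.

Lemma is_C1_comp (h dh : R -> R) f df : (forall x : R, is_derive x 1 h (dh x)) ->
  continuous dh -> is_C1 f df ->
  is_C1 (fun p => h (f p)) (fun p v => dh (f p) * df p v).
Proof.
move=> h' dhc Cf p; have [f' df'] := Cf p.
have hd : differentiable h (f p).
  by apply/derivable1_diffP; case: (h' (f p)).
have hf : differentiable (h \o f) p by exact: differentiable_comp.
split=> // v; have [dfE dfc] := df' v; split.
  have -> : 'D_v (fun p => h (f p)) p = 'd (h \o f) p v by exact: deriveE.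
  rewrite diff_comp//= -[X in 'd h _ X]deriveE// dfE deriv1E; last by case: (h' (f p)).
  by rewrite derive1E; have [_ ->] := h' (f p); rewrite /GRing.scale/= mulrC.
apply: cvgM => //; apply: (@continuous_comp _ _ _ f dh).
  exact: differentiable_continuous.
exact: dhc.
Qed.

Lemma is_C1_cos f df : is_C1 f df ->
  is_C1 (fun p => cos (f p)) (fun p v => - sin (f p) * df p v).
Proof.
apply: (@is_C1_comp cos (fun x => - sin x)).
by move=> x; apply: continuousN; exact: continuous_sin.
Qed.

Lemma is_C1_sin f df : is_C1 f df ->
  is_C1 (fun p => sin (f p)) (fun p v => cos (f p) * df p v).
Proof. by apply: (@is_C1_comp sin cos); exact: continuous_cos. Qed.

Lemma is_C1_linear f : linear f -> continuous f -> is_C1 f (fun _ v => f v).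
Proof.
move=> fl fc.
pose L := GRing.isLinear.Build R V R _ f fl.
pose lf : {linear V -> R} := HB.pack f L.
move=> p; have fd : differentiable f p by exact: (@linear_differentiable _ _ _ lf).
split=> // v; split; last exact: cst_continuous.
by rewrite deriveE// (@diff_lin _ _ _ lf).
Qed.

(** Trades the derivative assembled by the rules for a closed form. *)
Lemma is_C1_ext (f g : V -> R) df dg :
  is_C1 f df -> f =1 g -> (forall p v, df p v = dg p v) -> is_C1 g dg.
Proof.
move=> Cf /funext <- dfg; have <- // : df = dg.
by apply/funext => p; apply/funext => v.
Qed.

Lemma is_C1B (f g : V -> R) df dg :
  is_C1 f df -> is_C1 g dg ->
  is_C1 (fun p => f p - g p) (fun p v => df p v - dg p v).
Proof. by move=> Cf /is_C1N; exact: is_C1D. Qed.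

Lemma is_C1Ml (k : R) (f : V -> R) df :
  is_C1 f df -> is_C1 (fun p => k * f p) (fun p v => k * df p v).
Proof.
move=> Cf; refine (is_C1_ext (is_C1M (is_C1_cst k) Cf) _ _) => // p v.
by rewrite mulr0 addr0.
Qed.

End rules.

Lemma is_C1_coord n (i : 'I_n.+1) :
  is_C1 (fun u : 'rV[R]_n.+1 => u 0 i) (fun _ v => v 0 i).
Proof.
apply: is_C1_linear; last exact: coord_continuous.
by move=> a u v; rewrite !mxE.
Qed.

Lemma is_C1_snd (U : normedModType R) :
  is_C1 (fun p : U * R => p.2) (fun _ v => v.2).
Proof. by apply: is_C1_linear => //; move=> p; exact: cvg_snd. Qed.

Lemma is_C1_fst (U : normedModType R) (f : U -> R) df : is_C1 f df ->
  is_C1 (fun p : U * R => f p.1) (fun p v => df p.1 v.1).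
Proof.
move=> Cf p; have [f' df'] := Cf p.1.
have fstd : differentiable (fst : U * R -> U) p.
  by apply: linear_differentiable => q; exact: cvg_fst.
have fd : differentiable (f \o fst) p by exact: differentiable_comp.
split=> // v; have [dfE dfc] := df' v.1; split.
  have -> : 'D_v (fun p : U * R => f p.1) p = 'd (f \o fst) p v by exact: deriveE.
  rewrite diff_comp//= -[RHS]dfE deriveE//; congr ('d f _ _).
  by rewrite diff_lin// => q; exact: cvg_fst.
apply: (@continuous_comp _ _ _ fst (df^~ v.1)) => //; exact: cvg_fst.
Qed.

(** Passes from coordinates to the vector-valued map: the first two conclusions are the regularity
    asked by [C1_family], the third evaluates the differential in transversality proofs. *)
Lemma is_C1_rV (V : normedModType R) n (F : V -> 'rV[R]_n) (dF : V -> V -> 'rV[R]_n) :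
  (forall j, is_C1 (fun p => F p 0 j) (fun p v => dF p v 0 j)) ->
  forall p, [/\ differentiable F p, forall v, {for p, continuous ('D_v F)} &
    forall v, 'd F p v = dF p v].
Proof.
move=> CF.
have Fd p : differentiable F p.
  have -> : F = \sum_j (fun p => F p 0 j *: delta_mx 0 j).
    apply/funext => q; rewrite fct_sumE; apply/rowP => j.
    rewrite summxE (bigD1 j)//= big1 => [|k kj]; rewrite !mxE ?eqxx.
      by rewrite mulr1 addr0.
    by rewrite eq_sym (negbTE kj) mulr0.
  apply: differentiable_sum => j; apply: differentiableZl.
  by case: (CF j p).
have FD v : 'D_v F = dF^~ v.
  apply/funext => p; rewrite derive_mx; last exact: diff_derivable.
  by apply/rowP => j; rewrite mxE; have [_ /(_ v)[]] := CF j p.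
move=> p; split=> // v; last first.
  by rewrite -deriveE//; exact: (congr1 (@^~ p) (FD v)).
rewrite FD.
apply/(@cvgrPdist_lt _ _ _ (nbhs p) (nbhs_filter p)) => e e0.
have H : nbhs p [set q | forall j, `|dF p v 0 j - dF q v 0 j| < e].
  apply: (@filter_forall _ _ _ (nbhs p) (nbhs_filter p)) => j.
  have [_ /(_ v)[_]] := CF j p.
  by move=> /(@cvgrPdist_lt _ _ _ (nbhs p) (nbhs_filter p)); exact.
apply: filterS H => q qe /=.
rewrite [ltLHS]/Num.Def.normr/= mx_normrE; apply/bigmax_ltP; split => // -[i j] _ /=.
by rewrite !mxE (ord1 i); exact: qe.
Qed.

End C1_functions.

(** * Simplices of ellipses and their transversality to the two varieties *)

Section ellipse_families.
Variables (R : realType) (n : nat).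
Variables (A : 'rV[R]_n.+1 -> 'M[R]_3) (dA : 'rV[R]_n.+1 -> 'rV[R]_n.+1 -> 'M[R]_3).
Hypothesis CA : forall i j, is_C1 (fun u => A u i j) (fun u v => dA u v i j).

Lemma ellipse_simplex_continuous :
  continuous (fun t : std_simplex R n => ellipse (A (\val t))).
Proof.
apply: ellipse_continuous => i j t.
apply: (@continuous_comp _ _ _ set_val (fun u => A u i j)).
  exact: initial_continuous.
exact: (is_C1_continuous (CA i j)).
Qed.

Definition ellipse_simplex : simplex R (loop R) n := mkcts ellipse_simplex_continuous.

(** The extension of the family off the simplex required by [C1_family]; it is available because [A]
    is given on the whole row space. *)
Definition ellipse_jet (p : 'rV[R]_n.+1 * R) : 'rV[R]_3 :=
  cos p.2 *: row 0 (A p.1) + sin p.2 *: row 1 (A p.1).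

(** The first two terms vary the matrix, the last one moves along the ellipse. *)
Definition dellipse_jet (p q : 'rV[R]_n.+1 * R) : 'rV[R]_3 :=
  cos p.2 *: row 0 (dA p.1 q.1) + sin p.2 *: row 1 (dA p.1 q.1)
  + q.2 *: (cos p.2 *: row 1 (A p.1) - sin p.2 *: row 0 (A p.1)).

Lemma ellipse_jet_C1 j :
  is_C1 (fun p => ellipse_jet p 0 j) (fun p q => dellipse_jet p q 0 j).
Proof.
have CA1 i := is_C1_fst (CA i j).
have := is_C1D (is_C1M (is_C1_cos (@is_C1_snd R 'rV[R]_n.+1)) (CA1 0))
  (is_C1M (is_C1_sin (@is_C1_snd R 'rV[R]_n.+1)) (CA1 1)).
set g := (X in is_C1 X _); set dg := (X in is_C1 _ X).
have -> : g = fun p => ellipse_jet p 0 j by apply/funext => p; rewrite !mxE.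
have -> // : dg = fun p q => dellipse_jet p q 0 j.
by apply/funext => p; apply/funext => q; rewrite /dg !mxE; ring.
Qed.

Lemma ellipse_C1_family t : C1_family ellipse_simplex t ellipse_jet.
Proof.
split=> [u x|x]; first exact: esym (ellipseE _ _).
apply: (@filterE _ _ (nbhs_filter ((\val t, x) : 'rV[R]_n.+1 * R))) => p.
by have [] := is_C1_rV ellipse_jet_C1 p.
Qed.

Lemma ellipse_simplex_antipodal t x :
  ellipse_simplex t x = ellipse_simplex t (x + pi) <-> ellipse (A (\val t)) x = 0.
Proof.
rewrite /ellipse_simplex /mkcts ellipseDpi; split=> [/eqP|->]; last by rewrite oppr0.
by rewrite -subr_eq0 opprK -mulr2n -scaler_nat scaler_eq0 pnatr_eq0 => /eqP.
Qed.

(** Antipodal points of the ellipse are opposite, so their difference is twice the jet and it is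
    enough that the differential of the jet be onto. *)
Lemma ellipse_antipodal_transverse t :
  (forall x y, ellipse (A (\val t)) x = 0 -> ellipse (A (\val t)) y = 0 ->
    exists k : int, y - x = k%:~R * pi) ->
  (forall x, ellipse (A (\val t)) x = 0 -> forall w, exists v a,
    tangent v /\ dellipse_jet (\val t, x) (v, a) = w) ->
  antipodal_transverse ellipse_simplex t.
Proof.
move=> xuniq dsurj; split=> [x y|].
  by move=> /ellipse_simplex_antipodal ? /ellipse_simplex_antipodal; exact: xuniq.
exists ellipse_jet; split; first exact: ellipse_C1_family.
move=> x /ellipse_simplex_antipodal Ax w.
(* The factor 1/2 makes up for this doubling. *)
have [v [a [tv dv]]] := dsurj x Ax (2^-1 *: w).
exists v, a; split=> //.
have -> : (fun p => ellipse_jet p - ellipse_jet (p.1, p.2 + pi)) =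
    2 *: ellipse_jet.
  apply/funext => p; rewrite /ellipse_jet/= cosDpi sinDpi !scaleNr -opprD opprK.
  by rewrite fctE scaler_nat mulr2n.
have [Fd _ FD] := is_C1_rV ellipse_jet_C1 (\val t, x).
rewrite diffZ//= FD dv scalerA divff ?scale1r//; exact: lt0r_neq0.
Qed.

(** At the parameters 0 and pi the sine vanishes, and the difference of the two points is twice row
    0 of the matrix. *)
Lemma ellipse_base_antipodal_transverse t :
  (forall w, exists v, tangent v /\ row 0 (dA (\val t) v) = w) ->
  base_antipodal_transverse ellipse_simplex t.
Proof.
move=> dsurj; exists ellipse_jet; split; first exact: ellipse_C1_family.
move=> w; have [v [tv dv]] := dsurj (2^-1 *: w).
exists v; split=> //.
have -> : (fun u => ellipse_jet (u, 0) - ellipse_jet (u, pi)) =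
    2 *: (fun u => row 0 (A u)).
  apply/funext => u; rewrite /ellipse_jet/= cospi sinpi cos0 sin0 !scale0r !addr0.
  by rewrite scaleN1r opprK scale1r fctE scaler_nat mulr2n.
have CR j : is_C1 (fun u => (row 0 (A u)) 0 j) (fun u v => (row 0 (dA u v)) 0 j).
  have -> : (fun u => (row 0 (A u)) 0 j) = fun u => A u 0 j.
    by apply/funext => u; rewrite mxE.
  have -> // : (fun u v => (row 0 (dA u v)) 0 j) = fun u v => dA u v 0 j.
  by apply/funext => u; apply/funext => v'; rewrite mxE.
have [Fd _ FD] := is_C1_rV CR (\val t).
rewrite diffZ//= FD dv scalerA divff ?scale1r//; exact: lt0r_neq0.
Qed.

End ellipse_families.

(** Makes the generic lemmas on additive maps available for [boundary] and [eval]. *)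
HB.instance Definition _ (K : nzRingType) (T : choiceType) (M : lmodType K) (f : T -> M) :=
  GRing.isAdditive.Build {freeg T / K} M (fglift f) (lift_is_additive f).

(** * Singular chains mod 2 *)

Section chains.
Variables (R : realType) (X : topologicalType).

Lemma boundaryU n (s : simplex R X n.+1) :
  boundary << s >> = \sum_(i < n.+2) << face i s >> :> chain R X n.
Proof. by rewrite /boundary liftU scale1r. Qed.

Lemma boundaryD n (c d : chain R X n.+1) : boundary (c + d) = boundary c + boundary d.
Proof. exact: raddfD. Qed.

Lemma boundary_sum n (I : finType) (c : I -> chain R X n.+1) :
  boundary (\sum_i c i) = \sum_i boundary (c i).
Proof. exact: raddf_sum. Qed.

Lemma evalU n (f : cochain R X n) (s : simplex R X n) : eval f << s >> = f s.
Proof. by rewrite /eval liftU scale1r. Qed.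

Lemma evalD n (f : cochain R X n) (c d : chain R X n) :
  eval f (c + d) = eval f c + eval f d.
Proof. exact: (raddfD (fglift (f : simplex R X n -> ('F_2)^o))). Qed.

Lemma eval0 n (f : cochain R X n) : eval f 0 = 0.
Proof. exact: (raddf0 (fglift (f : simplex R X n -> ('F_2)^o))). Qed.

Lemma chain_addcc n (c : chain R X n) : c + c = 0.
Proof.
apply/eqP/freeg_eqP => s; rewrite coeffD coeff0.
by rewrite -mulr2n -mulr_natr (_ : 2%:R = 0 :> 'F_2) ?mulr0//; exact/val_inj.
Qed.

Lemma face_row_id n (i : 'I_n.+2) (t : 'rV[R]_n.+1) : face_row i t 0 i = 0.
Proof. by rewrite mxE unlift_none. Qed.

Lemma face_row_lift n (i : 'I_n.+2) (t : 'rV[R]_n.+1) k :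
  face_row i t 0 (lift i k) = t 0 k.
Proof. by rewrite mxE liftK. Qed.

Lemma face_rowE n (i : 'I_n.+2) (t : 'rV[R]_n.+1) j k :
  lift i k = j -> face_row i t 0 j = t 0 k.
Proof. by move=> <-; exact: face_row_lift. Qed.

(** The cosimplicial identity d_i d_j = d_(j+1) d_i for i <= j. Equal indices live in ordinals of
    different sizes, hence the primed copies tied by equality of values. *)
Lemma face_row_comp n (i : 'I_n.+3) (j i' : 'I_n.+2) (j' : 'I_n.+3)
    (t : 'rV[R]_n.+1) : (i <= j)%N -> i' = i :> nat -> j' = j.+1 :> nat ->
  face_row i (face_row j t) = face_row j' (face_row i' t).
Proof.
move=> ij ii' jj'; apply/rowP => k.
have [k1 ->|->] := unliftP i k; last first.
  rewrite face_row_id (_ : i = lift j' i') ?face_row_lift ?face_row_id//.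
  by apply: val_inj; rewrite /= /bump; lia.
rewrite face_row_lift; have [k2 ->|->] := unliftP j k1.
  have -> : lift i (lift j k2) = lift j' (lift i' k2).
    by apply: val_inj; rewrite /= /bump; lia.
  by rewrite !face_row_lift.
have -> : lift i j = j' by apply: val_inj; rewrite /= /bump; lia.
by rewrite !face_row_id.
Qed.

Lemma face_comp n (s : simplex R X n.+2) (i : 'I_n.+3) (j i' : 'I_n.+2) (j' : 'I_n.+3) :
  (i <= j)%N -> i' = i :> nat -> j' = j.+1 :> nat ->
  face j (face i s) = face i' (face j' s).
Proof.
move=> ij ii' jj'; apply/continuousEP => t; rewrite /face /=.
by congr (s _); apply/val_inj; exact: face_row_comp.
Qed.

Lemma boundary_boundary n (s : simplex R X n.+2) :
  boundary (boundary << s >>) = 0 :> chain R X n.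
Proof.
rewrite boundaryU boundary_sum.
under eq_bigr do rewrite boundaryU.
rewrite pair_bigA (bigID (fun ij : 'I_n.+3 * 'I_n.+2 => (ij.1 <= ij.2)%N)) /=.
(* The pairs with second entry below the first are the (j + 1, i) with i <= j. The truncation
   [inord] of i would take its default value only at i = n + 2, excluded by i <= j. By the
   simplicial identity the two halves are equal, and they cancel mod 2. *)
rewrite [X in _ + X](reindex_onto (fun ij : 'I_n.+3 * 'I_n.+2 => (lift ord0 ij.2, inord ij.1))
  (fun ij : 'I_n.+3 * 'I_n.+2 => (inord ij.2, inord ij.1.-1))) /=; last first.
  move=> [i j] /= ij; congr pair; apply: val_inj.
    by rewrite /= /bump/= inordK; have := ltn_ord i; lia.
  by rewrite /= !inordK; have := ltn_ord j; lia.
rewrite [X in _ + X](_ : _ = \sum_(ij : 'I_n.+3 * 'I_n.+2 | (ij.1 <= ij.2)%N)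
    << face ij.2 (face ij.1 s) >>); first exact: chain_addcc.
apply: eq_big => [[i j]|[i j] /andP[]] /=.
  have jn := ltn_ord j; have n2 (k : 'I_n.+2) : (k < n.+3)%N by exact: ltnW (ltn_ord k).
  have [ij|ji] := leqP i j; last first.
    apply/negbTE; rewrite negb_and negbK; apply/orP.
    have [|/eqP] := boolP (_ == _); last by right.
    move=> /eqP[/(congr1 (@nat_of_ord _)) + _]; rewrite (inordK (n2 _)) => ->; left.
    by rewrite /bump/=; lia.
  have iE : (inord i : 'I_n.+2) = i :> nat by rewrite inordK//; lia.
  rewrite iE -ltnNge /bump/= add1n ltnS ij; apply/eqP.
  congr pair; apply: val_inj => /=; last by rewrite inordK.
  by rewrite inordK//; lia.
move=> + /eqP[ij _]; rewrite -ltnNge /bump/= add1n ltnS => ij'.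
have iE : (inord i : 'I_n.+2) = i :> nat.
  rewrite -[in RHS]ij; apply/esym/inordK; exact: ltnW (ltn_ord _).
have jE : lift ord0 j = j.+1 :> nat by [].
rewrite iE in ij'.
by rewrite (face_comp s ij' iE jE).
Qed.

End chains.

(** * Coordinates in dimensions three and four *)

Section small_vectors.
Variable R : realType.

Lemma vec3P (v : 'rV[R]_3) a b c :
  v 0 0 = a -> v 0 1 = b -> v 0 2%:R = c -> v = vec3 a b c.
Proof.
move=> <- <- <-; apply/rowP => -[[|[|[|//]]] ij]; rewrite !mxE /=;
  by congr (v _ _); apply/val_inj.
Qed.

Lemma sum3E (W : nmodType) (F : 'I_3 -> W) : \sum_i F i = F 0 + F 1 + F 2%:R.
Proof.
rewrite !big_ord_recl big_ord0 addr0 addrA.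
by congr (_ + F _ + F _); apply/val_inj.
Qed.

(** A product of equations, so that it serves as a single rewriting multirule. *)
Lemma vec3E (a b c : R) : ((vec3 a b c) 0 0 = a) * ((vec3 a b c) 0 1 = b)
  * ((vec3 a b c) 0 2%:R = c).
Proof. by rewrite !mxE. Qed.

Lemma sum4E (W : nmodType) (F : 'I_4 -> W) : \sum_i F i = F 0 + F 1 + F 2%:R + F 3%:R.
Proof.
rewrite !big_ord_recl big_ord0 addr0 !addrA.
by congr (_ + F _ + F _ + F _); apply/val_inj.
Qed.

Definition vec4 (a b c d : R) : 'rV[R]_4 := \row_i [:: a; b; c; d]`_i.

Lemma vec4P (v : 'rV[R]_4) a b c d :
  v 0 0 = a -> v 0 1 = b -> v 0 2%:R = c -> v 0 3%:R = d -> v = vec4 a b c d.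
Proof.
move=> <- <- <- <-; apply/rowP => -[[|[|[|[|//]]]] ij]; rewrite !mxE /=;
  by congr (v _ _); apply/val_inj.
Qed.

Lemma vec4E (a b c d : R) : ((vec4 a b c d) 0 0 = a) * ((vec4 a b c d) 0 1 = b)
  * ((vec4 a b c d) 0 2%:R = c) * ((vec4 a b c d) 0 3%:R = d).
Proof. by rewrite !mxE. Qed.

End small_vectors.

(** * Simplices meeting a variety in one interior point *)

Section single_intersection.
Variables (R : realType) (V : set (loop R)).
Variable transverse : forall n, simplex R (loop R) n -> std_simplex R n -> Prop.

Lemma single_intersection n (s : simplex R (loop R) n) (t : std_simplex R n) :
  (forall u, V (s u) <-> u = t) -> (forall i, 0 < \val t 0 i) -> transverse s t ->
  generic_chain V transverse << s >> /\ intersection_number V << s >> = 1.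
Proof.
move=> Vs t0 tr.
have VE : s @^-1` V = [set t] by apply/seteqP; split=> u /=; rewrite Vs.
split; last by rewrite /intersection_number evalU VE fset_set1 cardfs1.
move=> s'; rewrite domU1 inE => /eqP ->; split; first by rewrite VE.
by move=> u /Vs ->.
Qed.

End single_intersection.

(** Keeps the two glued edges of the disk off the variety. Below 1/2 the cosine is positive, and
    above it 2 x exceeds 1. *)
Lemma cos_piMDgt0 (R : realType) (x : R) : 0 <= x <= 1 -> 0 < 2 * x + cos (pi * x).
Proof.
move=> /andP[x0 x1]; have pi0 := pi_gt0 R.
have [xh|xh|->] := ltgtP x (1 / 2).
- rewrite ltr_wpDl ?mulr_ge0//; apply: cos_gt0_pihalf; apply/andP; split; nra.
- by have := cos_geN1 (pi * x); lra.
- by rewrite mulrCA mul1r mulrA cos_pihalf; lra.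
Qed.

Lemma sin_pihalf_eq0 (R : realType) (x : R) : -1 <= x <= 1 ->
  sin (pi * x / 2) = 0 -> x = 0.
Proof.
move=> /andP[x0 x1]; have pi0 := pi_gt0 R; rewrite -[RHS in _ = RHS -> _]sin0 => sx.
have : pi * x / 2 = 0.
  by apply: sin_inj => //; rewrite in_itv/=; apply/andP; split; nra.
by move=> /eqP; rewrite !mulf_eq0 invr_eq0 pnatr_eq0/= orbF gt_eqF//= => /eqP.
Qed.

(** * The matrices of the disk of ellipses *)

Section rotating_circle_filling.
Variables (R : realType) (theta : R).
Let u : 'rV[R]_3 := vec3 (cos theta) (sin theta) 0.

(* On the edge [r 0 0 = 0] the pair [(disk_p, disk_q)] is
   [(cos (2 pi r 0 2), sin (2 pi r 0 2))]; it is symmetric in [r 0 1] and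
   [r 0 2] up to the sign of [disk_q], which vanishes on the other two edges,
   so these two edges give the same simplex. *)
Definition disk_p (r : 'rV[R]_3) : R := 2 * r 0 0 - cos (pi * (r 0 2%:R - r 0 1)).
Definition disk_q (r : 'rV[R]_3) : R :=
  sin (pi * r 0 2%:R) - sin (pi * r 0 1) + sin (pi * (r 0 1 - r 0 2%:R)).
Definition disk_dp (r v : 'rV[R]_3) : R :=
  2 * v 0 0 + sin (pi * (r 0 2%:R - r 0 1)) * (pi * (v 0 2%:R - v 0 1)).
Definition disk_dq (r v : 'rV[R]_3) : R :=
  cos (pi * r 0 2%:R) * (pi * v 0 2%:R) - cos (pi * r 0 1) * (pi * v 0 1)
  + cos (pi * (r 0 1 - r 0 2%:R)) * (pi * (v 0 1 - v 0 2%:R)).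

(** Rodrigues' formula with any pair (p, q) in place of the cosine and sine of the angle. *)
Definition rotation_like (p q : R) : 'M[R]_3 :=
  u^T *m u + p *: (1%:M - u^T *m u) + q *: \matrix_i cross u (delta_mx 0 i).

Definition disk_mx (r : 'rV[R]_3) : 'M[R]_3 := rotation_like (disk_p r) (disk_q r).
Definition disk_dmx (r v : 'rV[R]_3) : 'M[R]_3 :=
  disk_dp r v *: (1%:M - u^T *m u) + disk_dq r v *: \matrix_i cross u (delta_mx 0 i).

Lemma disk_p_C1 : is_C1 disk_p disk_dp.
Proof.
have C i := @is_C1_coord R 2 i.
refine (is_C1_ext (is_C1B (is_C1Ml 2 (C 0))
  (is_C1_cos (is_C1Ml pi (is_C1B (C 2%:R) (C 1))))) _ _) => // r v.
by rewrite /disk_dp mulNr opprK.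
Qed.

Lemma disk_q_C1 : is_C1 disk_q disk_dq.
Proof.
have C i := @is_C1_coord R 2 i.
exact: (is_C1D (is_C1B (is_C1_sin (is_C1Ml pi (C 2%:R))) (is_C1_sin (is_C1Ml pi (C 1))))
  (is_C1_sin (is_C1Ml pi (is_C1B (C 1) (C 2%:R))))).
Qed.

Lemma disk_mx_C1 i j : is_C1 (fun r => disk_mx r i j) (fun r v => disk_dmx r v i j).
Proof.
pose B1 : 'M[R]_3 := 1%:M - u^T *m u.
pose B2 : 'M[R]_3 := \matrix_i cross u (delta_mx 0 i).
refine (is_C1_ext (is_C1D (is_C1D (is_C1_cst ((u^T *m u) i j))
  (is_C1Ml (B1 i j) disk_p_C1)) (is_C1Ml (B2 i j) disk_q_C1)) _ _).
  by move=> r; rewrite /disk_mx /rotation_like -/B1 -/B2 [RHS]mxE [X in _ = X + _]mxE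
    [X in _ = _ + X + _]mxE [X in _ = _ + X]mxE (mulrC (B1 i j)) (mulrC (B2 i j)).
move=> r v; rewrite add0r /disk_dmx -/B1 -/B2 [RHS]mxE [X in _ = X + _]mxE
  [X in _ = _ + X]mxE.
by rewrite (mulrC (B1 i j)) (mulrC (B2 i j)).
Qed.

End rotating_circle_filling.

(** * Rotated circles, and the knots among their deformations *)

Section rotations.
Variables (R : realType) (theta : R).
Local Notation c := (cos theta).
Local Notation s := (sin theta).

(** Here a c + b s and b c - a s are the components along the axis u and along v = (- s, c, 0). The
    matrix fixes u and sends v to p v + q e3. *)
Lemma vec3_mul_rotation_like (p q a b : R) :
  vec3 a b 0 *m rotation_like theta p q =
  vec3 ((a * c + b * s) * c - (b * c - a * s) * s * p)
       ((a * c + b * s) * s + (b * c - a * s) * c * p)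
       ((b * c - a * s) * q).
Proof.
have c2 : c ^+ 2 = 1 - s ^+ 2 by exact: cos2sin2.
apply: vec3P; rewrite mxE sum3E !vec3E mul0r addr0 /rotation_like /cross /vec3 !mxE !big_ord1 !mxE/=;
  by rewrite ?(mulr0, mul0r, mulr1, mul1r, addr0, add0r, subr0, sub0r, mulr0n, mulr1n); ring: c2.
Qed.

Lemma rotation_likeE (p q x : R) : ellipse (rotation_like theta p q) x =
  vec3 (cos (x - theta) * c - sin (x - theta) * s * p)
       (cos (x - theta) * s + sin (x - theta) * c * p)
       (sin (x - theta) * q).
Proof. by rewrite cosB sinB -vec3_mul_rotation_like. Qed.

(** These are the components of the image in the orthonormal frame (u, v, e3); the combinations
    below are scalar products with u and v. *)
Lemma rotation_like_eq0 (p q a b : R) : vec3 a b 0 *m rotation_like theta p q = 0 ->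
  [/\ a * c + b * s = 0, (b * c - a * s) * p = 0 & (b * c - a * s) * q = 0].
Proof.
rewrite vec3_mul_rotation_like => /rowP e.
have c2 : c ^+ 2 = 1 - s ^+ 2 by exact: cos2sin2.
have := e 0; have := e 1; have := e 2%:R; rewrite !vec3E !mxE => e2 e1 e0.
split=> //.
  transitivity (c * ((a * c + b * s) * c - (b * c - a * s) * s * p) +
    s * ((a * c + b * s) * s + (b * c - a * s) * c * p)); first by ring: c2.
  by rewrite e0 e1 !mulr0 addr0.
transitivity (c * ((a * c + b * s) * s + (b * c - a * s) * c * p) -
    s * ((a * c + b * s) * c - (b * c - a * s) * s * p)); first by ring: c2.
by rewrite e0 e1 !mulr0 subr0.
Qed.

Lemma knot_rotation_like (p q : R) : (p, q) != (0, 0) ->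
  knots (ellipse (rotation_like theta p q)).
Proof.
move=> pq; apply: knot_ellipse => a b ab0.
have [C0 Sp Sq] : [/\ a * c + b * s = 0, (b * c - a * s) * p = 0 &
    (b * c - a * s) * q = 0].
  by apply: rotation_like_eq0; rewrite vec3_mulmx scale0r addr0.
have S0 : b * c - a * s = 0.
  apply/eqP; apply: contraNT pq => S0; apply/eqP; congr pair.
    by apply: (mulfI S0); rewrite mulr0.
  by apply: (mulfI S0); rewrite mulr0.
have c2 : c ^+ 2 = 1 - s ^+ 2 by exact: cos2sin2.
split.
  transitivity (c * (a * c + b * s) - s * (b * c - a * s)); first by ring: c2.
  by rewrite C0 S0 !mulr0 subr0.
transitivity (s * (a * c + b * s) + c * (b * c - a * s)); first by ring: c2.
by rewrite C0 S0 !mulr0 addr0.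
Qed.

Lemma knot_rotation a :
  knots (ellipse (rotation (vec3 c s 0) a)).
Proof.
apply: (@knot_rotation_like (cos a) (sin a)).
apply/eqP => -[ca sa]; have := cos2Dsin2 a.
by rewrite ca sa expr0n addr0 => /eqP; rewrite eq_sym oner_eq0.
Qed.

Lemma rotation0 : ellipse (rotation (vec3 c s 0) 0) = std_circle R.
Proof.
apply: loop_ext => x; rewrite [LHS](@rotation_likeE (cos 0) (sin 0)) cos0 sin0.
rewrite mulr0 !mulr1 cosB sinB /=.
have c2 : c ^+ 2 = 1 - s ^+ 2 by exact: cos2sin2.
by congr vec3; ring: c2.
Qed.

(** The rotations of angles from 0 to a form a path of knots starting at the standard circle. *)
Lemma rotation_unknot a : 0 <= a ->
  unknots (ellipse (rotation (vec3 c s 0) a)).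
Proof.
move=> a0; rewrite /unknots -rotation0.
apply: ellipse_path_component => // [i j|t _]; last exact: knot_rotation.
move=> t; rewrite /rotation.
under eq_fun do rewrite !mxE.
apply: cvgD; first apply: cvgD; first exact: cvg_cst.
- by apply: cvgM; [exact: continuous_cos|exact: cvg_cst].
- by apply: cvgM; [exact: continuous_sin|exact: cvg_cst].
Qed.

Lemma rotating_circle_unknot t : unknots (rotating_circle theta t).
Proof.
apply: rotation_unknot; case: t => t /= /set_mem[t0 _].
by apply: mulr_ge0; [exact/mulrn_wge0/pi_ge0|exact: t0].
Qed.

End rotations.

Section ellipse_faces.
Variable R : realType.

Lemma face_ellipse_simplex n (A : 'rV[R]_n.+2 -> 'M[R]_3)
    (dA : 'rV[R]_n.+2 -> 'rV[R]_n.+2 -> 'M[R]_3)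
    (CA : forall i j, is_C1 (fun r => A r i j) (fun r v => dA r v i j)) i t :
  face i (ellipse_simplex CA) t = ellipse (A (face_row i (\val t))).
Proof. by []. Qed.

End ellipse_faces.

(** * The disk filling the cycle of rotations, and its single intersection *)

Section disk.
Variables (R : realType) (theta : R).
Local Notation c := (cos theta).
Local Notation s := (sin theta).

Definition disk : simplex R (loop R) 2 := ellipse_simplex (disk_mx_C1 theta).

Definition disk_center_row : 'rV[R]_3 := vec3 (1 / 2) (1 / 4) (1 / 4).

Lemma disk_center_subproof : disk_center_row \in std_simplex R 2.
Proof.
apply/mem_set; split; last by rewrite sum3E !vec3E; field.
by case=> -[|[|[|//]]] i; rewrite !mxE/=.
Qed.

Definition disk_center : std_simplex R 2 :=
  exist (fun t => t \in std_simplex R 2) _ disk_center_subproof.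

(** By sum-to-product formulas. On the simplex, [disk_q] thus vanishes only on the median r 0 1 = r
    0 2 and on the edges r 0 1 = 0 and r 0 2 = 0. *)
Lemma disk_qE (r : 'rV[R]_3) : disk_q r = 4 * (sin (pi * (r 0 1 - r 0 2%:R) / 2)
  * sin (pi * r 0 1 / 2) * sin (pi * r 0 2%:R / 2)).
Proof.
rewrite /disk_q; set a := pi * r 0 1 / 2; set b := pi * r 0 2%:R / 2.
have -> : pi * r 0 1 = a *+ 2 by rewrite /a; field.
have -> : pi * r 0 2%:R = b *+ 2 by rewrite /b; field.
have -> : pi * (r 0 1 - r 0 2%:R) = (a - b) *+ 2 by rewrite /a /b; field.
have -> : (a - b) *+ 2 / 2 = a - b by field.
rewrite !sin_mulr2n cosB sinB.
have ca := cos2sin2 a; have cb := cos2sin2 b.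
by ring: ca cb.
Qed.

(** On the median p = 2 r 0 0 - 1, which gives the centre. On both edges p = 2 x + cos (pi x) with x
    = r 0 0, which is positive. *)
Lemma disk_pq_eq0 (r : 'rV[R]_3) : std_simplex R 2 r ->
  disk_p r = 0 -> disk_q r = 0 -> r = disk_center_row.
Proof.
move=> [r0]; rewrite sum3E => r1 p0; rewrite disk_qE => /eqP.
have := r0 0; have := r0 1; have := r0 2%:R => r02 r01 r00.
have p_pos x : 0 <= x <= 1 -> r 0 0 = x -> cos (pi * (r 0 2%:R - r 0 1)) = - cos (pi * x) -> False.
  by move=> /cos_piMDgt0 + rx cx; move: p0; rewrite /disk_p cx rx; lra.
rewrite !mulf_eq0 pnatr_eq0/= => /orP[/orP[|]|] /eqP /sin_pihalf_eq0 => [e|e|e].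
- have {}e : r 0 1 = r 0 2%:R by apply/eqP; rewrite -subr_eq0 e//; lra.
  move: p0; rewrite /disk_p e subrr mulr0 cos0 => p0.
  by apply: vec3P; lra.
- have {}e : r 0 1 = 0 by apply: e; lra.
  exfalso; apply: (p_pos (r 0 0)) => //; first lra.
  by rewrite (_ : _ * _ = - (pi * r 0 0) + pi) ?cosDpi ?cosN//; rewrite (_ : r 0 2%:R = 1 - r 0 0) ?e; lra.
- have {}e : r 0 2%:R = 0 by apply: e; lra.
  exfalso; apply: (p_pos (r 0 0)) => //; first lra.
  have -> : r 0 1 = 1 - r 0 0 by lra.
  rewrite e (_ : _ * _ = - (- (pi * r 0 0) + pi)); last by ring.
  by rewrite cosN cosDpi cosN.
Qed.

Lemma disk_center_pq : disk_p disk_center_row = 0 /\ disk_q disk_center_row = 0.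
Proof.
rewrite /disk_p /disk_q !vec3E !subrr mulr0 cos0 sin0 addr0; split=> //; lra.
Qed.

Lemma disk_antipodal t : antipodal_variety (disk t) <-> t = disk_center.
Proof.
split=> [[x /ellipse_simplex_antipodal]|->]; last first.
  (* At the centre the ellipse flattens to cos (x - theta) u, which vanishes here. *)
  exists (theta + pi / 2); apply/ellipse_simplex_antipodal.
  have [p0 q0] := disk_center_pq.
  rewrite [LHS]rotation_likeE p0 q0 addrAC subrr add0r cos_pihalf !(mul0r, mulr0, subr0, addr0).
  by apply/esym/vec3P; rewrite mxE.
rewrite /ellipse /= => /rotation_like_eq0[C0 Sp Sq].
(* The component along u is cos (x - theta) = 0, so sin (x - theta) is not zero and can be cancelled
   from the other two equations. *)
have S0 : sin x * c - cos x * s != 0.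
  rewrite -sinB; apply/eqP => S0; have := cos2Dsin2 (x - theta).
  by rewrite S0 cosB C0 expr0n addr0 => /eqP; rewrite eq_sym oner_eq0.
apply: val_inj; apply: disk_pq_eq0.
- by case: t {Sp Sq} => r rt; exact: set_mem rt.
- by apply: (mulfI S0); rewrite mulr0.
- by apply: (mulfI S0); rewrite mulr0.
Qed.

Lemma disk_transverse : antipodal_transverse disk disk_center.
Proof.
have [p0 q0] := disk_center_pq.
have zero x : ellipse (disk_mx theta (\val disk_center)) x = 0 -> cos (x - theta) = 0.
  by rewrite cosB /ellipse /= => /rotation_like_eq0[].
apply: ellipse_antipodal_transverse => [x y /zero cx /zero cy|x /zero cx w].
  have [k kE] := cos_eq0_congr cx cy; exists k; rewrite -kE; ring.
pose S := sin (x - theta).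
have S2 : S ^+ 2 = 1 by rewrite sin2cos2 cx expr0n subr0.
(* At the centre the differential of (p, q) sends (v_0, v_1, v_2) to (2 v_0, K (v_1 - v_2)). The
   increments P of p and K Q of q produce the components of w orthogonal to u; moving the parameter
   x produces the one along u. *)
pose K : R := pi * (1 - cos (pi * (1 / 4))).
pose P := S * (w 0 1 * c - w 0 0 * s).
pose Q := S * w 0 2%:R / K.
exists (vec3 (P / 2) (Q / 2 - P / 4) (- Q / 2 - P / 4)), (- S * (w 0 0 * c + w 0 1 * s)).
split; first by rewrite /tangent sum3E !vec3E; field.
(* As a difference of two such matrices, the differential is covered by the product formula. *)
have dA v : disk_dmx theta disk_center_row v =
    rotation_like theta (disk_dp disk_center_row v) (disk_dq disk_center_row v)
    - rotation_like theta 0 0.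
  by rewrite /disk_dmx /rotation_like !scale0r !addr0 [RHS]addrC -addrA addKr.
have jetE p q (B : 'M[R]_3) : p *: row 0 B + q *: row 1 B = vec3 p q 0 *m B.
  by rewrite vec3_mulmx scale0r addr0.
have pi0 := pi_gt0 R.
have cpi4 : cos (pi * (1 / 4)) < 1 :> R.
  have h1 : 0 < pi * (1 / 4) :> R by rewrite mulr_gt0.
  have h2 : pi * (1 / 4) <= pi :> R by lra.
  by rewrite -[ltRHS]cos0 ltr_cos ?in_itv/= ?lexx ?pi_ge0 ?h2 ?(ltW h1).
have K0 : K != 0 by rewrite /K mulf_neq0 ?gt_eqF// subr_gt0.
have dpE : disk_dp disk_center_row (vec3 (P / 2) (Q / 2 - P / 4) (- Q / 2 - P / 4)) = P.
  by rewrite /disk_dp !vec3E subrr mulr0 sin0 mul0r addr0; field.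
have dqE : disk_dq disk_center_row (vec3 (P / 2) (Q / 2 - P / 4) (- Q / 2 - P / 4)) =
    S * w 0 2%:R.
  rewrite /disk_dq !vec3E subrr mulr0 cos0 -[RHS](@divfK _ K)// -/Q /K.
  by move: (cos _) (Q) (P) => k q p; field.
rewrite /dellipse_jet /= addrC [cos x *: _ - _]addrC -scaleNr !jetE dA mulmxBr.
rewrite /disk_mx p0 q0 !vec3_mul_rotation_like dpE dqE -cosB -sinB cx -/S.
have -> : - sin x * c + cos x * s = - S by rewrite /S sinB; ring.
rewrite [RHS](@vec3P _ w _ _ _ erefl erefl erefl) /P.
have c2 : c ^+ 2 = 1 - s ^+ 2 by exact: cos2sin2.
apply: vec3P; rewrite !mxE/=; ring: S2 c2.
Qed.

Lemma disk_face0 : face 0 disk = rotating_circle theta.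
Proof.
apply/continuousEP => t; rewrite face_ellipse_simplex.
set r := face_row _ _.
have r0 : r 0 0 = 0 by exact: face_row_id.
have r1 : r 0 1 = \val t 0 0 by apply: face_rowE; exact/val_inj.
have r2 : r 0 2%:R = \val t 0 1 by apply: face_rowE; exact/val_inj.
have t01 : \val t 0 0 = 1 - \val t 0 1.
  have [_] := set_mem (valP t); rewrite !big_ord_recl big_ord0 addr0 => <-.
  by rewrite (_ : lift _ _ = 1) ?addrK//; exact/val_inj.
rewrite /= /rotating_circle_fun -/(ellipse _) /disk_mx; congr (ellipse _).
rewrite /rotation /rotation_like /disk_p /disk_q r0 r1 r2 t01.
set x := \val t 0 1.
have -> : pi * (x - (1 - x)) = pi *+ 2 * x - pi by ring.
have -> : pi * ((1 - x) - x) = - (pi *+ 2 * x) + pi by ring.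
have -> : pi * (1 - x) = - (pi * x) + pi by ring.
rewrite !sinDpi !sinN !opprK subrr add0r mulr0 sub0r.
by rewrite cosB cospi sinpi mulr0 addr0 mulrN1 opprK.
Qed.

Lemma disk_face12 : face 1 disk = face 2%:R disk.
Proof.
apply/continuousEP => t; rewrite !face_ellipse_simplex.
set r := face_row _ _; set r' := face_row _ _.
have r0 : r 0 0 = \val t 0 0 by apply: face_rowE; exact/val_inj.
have r1 : r 0 1 = 0 by exact: face_row_id.
have r2 : r 0 2%:R = \val t 0 1 by apply: face_rowE; exact/val_inj.
have r'0 : r' 0 0 = \val t 0 0 by apply: face_rowE; exact/val_inj.
have r'1 : r' 0 1 = \val t 0 1 by apply: face_rowE; exact/val_inj.
have r'2 : r' 0 2%:R = 0 by exact: face_row_id.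
rewrite /disk_mx; congr (ellipse (rotation_like _ _ _)).
  by rewrite /disk_p r0 r1 r2 r'0 r'1 r'2 subr0 sub0r mulrN cosN.
rewrite /disk_q r1 r2 r'1 r'2 subr0 sub0r mulrN mulr0 sin0 sinN; ring.
Qed.

Lemma boundary_disk : boundary << disk >> = << rotating_circle theta >>.
Proof. by rewrite boundaryU sum3E disk_face0 disk_face12 -addrA chain_addcc addr0. Qed.

Lemma boundary_rotating_circle : boundary << rotating_circle theta >> = 0.
Proof. by rewrite -boundary_disk boundary_boundary. Qed.

Lemma rotating_circle_cycle :
  cycle_in (@unknots R) (<< rotating_circle theta >> : chain R (loop R) 1).
Proof.
split; last exact: boundary_rotating_circle.
move=> s'; rewrite domU1 inE => /eqP -> t; exact: rotating_circle_unknot.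
Qed.

Lemma rotating_circle_linking (l : cochain R (loop R) 1) :
  is_linking_class (@antipodal_variety R) (@antipodal_transverse R) l ->
  eval l << rotating_circle theta >> = 1.
Proof.
move=> [_ ll].
have [gen int1] : generic_chain (@antipodal_variety R) (@antipodal_transverse R) << disk >>
    /\ intersection_number (@antipodal_variety R) << disk >> = 1.
  apply: single_intersection disk_antipodal _ disk_transverse => i.
  by case: i => -[|[|[|//]]] i; rewrite !mxE/=.
rewrite (ll _ _ _ boundary_disk gen)//.
have [rc b0] := rotating_circle_cycle; split=> // s' /rc st t.
exact: connected_component_sub (st t).
Qed.

End disk.

(** * The 3-simplex of ellipses *)

Section ball.
Variable R : realType.
Implicit Types r v : 'rV[R]_4.

(* The signs of [(y, z)] are opposite on the identified faces [r 0 0 = 0] and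
   [r 0 2 = 0], where [w = 0]; [frame_mx] is even in [(w, y, z)]. *)
Definition ball_w r : R := r 0 0 * r 0 2%:R.
Definition ball_y r : R := r 0 0 - r 0 1 + r 0 2%:R.
Definition ball_z r : R := r 0 1 * (r 0 0 - r 0 2%:R).
(* The factor 1 / 125 puts the zero of the first row of [ball_mx] at the
   rational point (1/5, 2/5, 1/5, 1/5). *)
Definition ball_h r : R := 125%:R^-1 * r 0 3%:R.

Definition ball_dw r v : R := r 0 0 * v 0 2%:R + r 0 2%:R * v 0 0.
Definition ball_dy r v : R := v 0 0 - v 0 1 + v 0 2%:R.
Definition ball_dz r v : R :=
  r 0 1 * (v 0 0 - v 0 2%:R) + (r 0 0 - r 0 2%:R) * v 0 1.
Definition ball_dh r v : R := 125%:R^-1 * v 0 3%:R.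

(* For [h = 0] and n = (w, y, z), these are the first two rows of
   2 n^T n - |n|^2, a multiple of the rotation of angle pi around n. The third
   row plays no role, as [std_circle] lies in the plane of the first two
   coordinates. *)
Definition frame_mx (w y z h : R) : 'M[R]_3 := \matrix_i
  [:: vec3 (w * w - y * y - z * z - h) (2 * (w * y)) (2 * (w * z));
      vec3 (2 * (w * y)) (y * y - w * w - z * z + h) (2 * (y * z)); 0]`_i.

Definition frame_dmx (w y z dw dy dz dh : R) : 'M[R]_3 := \matrix_i
  [:: vec3 (2 * (w * dw) - 2 * (y * dy) - 2 * (z * dz) - dh)
        (2 * (w * dy + y * dw)) (2 * (w * dz + z * dw));
      vec3 (2 * (w * dy + y * dw))
        (2 * (y * dy) - 2 * (w * dw) - 2 * (z * dz) + dh)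
        (2 * (y * dz + z * dy)); 0]`_i.

Definition ball_mx r := frame_mx (ball_w r) (ball_y r) (ball_z r) (ball_h r).
Definition ball_dmx r v := frame_dmx (ball_w r) (ball_y r) (ball_z r)
  (ball_dw r v) (ball_dy r v) (ball_dz r v) (ball_dh r v).

Lemma ball_mx_C1 i j : is_C1 (fun r => ball_mx r i j) (fun r v => ball_dmx r v i j).
Proof.
have C k := @is_C1_coord R 3 k.
have Cw : is_C1 ball_w ball_dw by exact: is_C1M.
have Cy : is_C1 ball_y ball_dy by exact: (is_C1D (is_C1B (C 0) (C 1)) (C 2%:R)).
have Cz : is_C1 ball_z ball_dz by exact: is_C1M (C 1) (is_C1B (C 0) (C 2%:R)).
have Ch : is_C1 ball_h ball_dh by exact: is_C1Ml.
case: i => -[|[|[|//]]] i; case: j => -[|[|[|//]]] j;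
  [ refine (is_C1_ext (is_C1B (is_C1B (is_C1B (is_C1M Cw Cw) (is_C1M Cy Cy)) (is_C1M Cz Cz)) Ch) _ _)
  | refine (is_C1_ext (is_C1Ml 2 (is_C1M Cw Cy)) _ _)
  | refine (is_C1_ext (is_C1Ml 2 (is_C1M Cw Cz)) _ _)
  | refine (is_C1_ext (is_C1Ml 2 (is_C1M Cw Cy)) _ _)
  | refine (is_C1_ext (is_C1D (is_C1B (is_C1B (is_C1M Cy Cy) (is_C1M Cw Cw)) (is_C1M Cz Cz)) Ch) _ _)
  | refine (is_C1_ext (is_C1Ml 2 (is_C1M Cy Cz)) _ _)
  | refine (is_C1_ext (is_C1_cst 0) _ _)..];
  move=> *; rewrite ?mxE /= ?mxE //=; ring.
Qed.

Definition ball3 : simplex R (loop R) 3 := ellipse_simplex ball_mx_C1.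

Lemma row0_frame w y z h : row 0 (frame_mx w y z h) =
  vec3 (w * w - y * y - z * z - h) (2 * (w * y)) (2 * (w * z)).
Proof. by apply/rowP => j; rewrite !mxE /= ?mxE. Qed.

Lemma row1_frame w y z h : row 1 (frame_mx w y z h) =
  vec3 (2 * (w * y)) (y * y - w * w - z * z + h) (2 * (y * z)).
Proof. by apply/rowP => j; rewrite !mxE /= ?mxE. Qed.

Lemma frame_comb0 w y z h a b :
  a *: row 0 (frame_mx w y z h) + b *: row 1 (frame_mx w y z h) = 0 ->
  [/\ a * (w * w - y * y - z * z - h) + b * (2 * (w * y)) = 0,
      a * (2 * (w * y)) + b * (y * y - w * w - z * z + h) = 0 &
      a * (2 * (w * z)) + b * (2 * (y * z)) = 0].
Proof.
rewrite row0_frame row1_frame => /rowP e.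
by have := e 0; have := e 1; have := e 2%:R; rewrite !mxE.
Qed.

(** The matrix 2 n^T n - |n|^2 is symmetric of square |n|^4, so applying it to the relation
    multiplies (a, b) by |n|^4. *)
Lemma knot_frame_h0 w y z : (w, y, z) != (0, 0, 0) -> knots (ellipse (frame_mx w y z 0)).
Proof.
move=> wyz; apply: knot_ellipse => a b /frame_comb0[e0 e1 e2].
have D0 : (w ^+ 2 + y ^+ 2 + z ^+ 2) ^+ 2 != 0.
  rewrite sqrf_eq0; apply: contraNneq wyz => D0; apply/eqP.
  have w0 := sqr_ge0 w; have y0 := sqr_ge0 y; have z0 := sqr_ge0 z.
  have {}w0 : w ^+ 2 = 0 by lra.
  have {}y0 : y ^+ 2 = 0 by lra.
  have {}z0 : z ^+ 2 = 0 by lra.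
  by move/eqP: w0; move/eqP: y0; move/eqP: z0; rewrite !sqrf_eq0 => /eqP -> /eqP -> /eqP ->.
split; apply: (mulIf D0); rewrite mul0r.
  transitivity ((w * w - y * y - z * z) * (a * (w * w - y * y - z * z - 0) + b * (2 * (w * y)))
    + 2 * (w * y) * (a * (2 * (w * y)) + b * (y * y - w * w - z * z + 0))
    + 2 * (w * z) * (a * (2 * (w * z)) + b * (2 * (y * z)))); first by ring.
  by rewrite e0 e1 e2 !mulr0 !addr0.
transitivity (2 * (w * y) * (a * (w * w - y * y - z * z - 0) + b * (2 * (w * y)))
    + (y * y - w * w - z * z) * (a * (2 * (w * y)) + b * (y * y - w * w - z * z + 0))
    + 2 * (y * z) * (a * (2 * (w * z)) + b * (2 * (y * z)))); first by ring.
by rewrite e0 e1 e2 !mulr0 !addr0.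
Qed.

(** The upper left block is symmetric with diagonal (X, - X) and off-diagonal entry 2 Y, so its
    square is X^2 + 4 Y^2. *)
Lemma knot_frame_z0 w y h : (w * y, w * w - y * y - h) != (0, 0) ->
  knots (ellipse (frame_mx w y 0 h)).
Proof.
move=> wyh; apply: knot_ellipse => a b /frame_comb0[e0 e1 _].
set X := w * w - y * y - h in wyh; set Y := w * y in wyh e0 e1.
have D0 : X ^+ 2 + 4 * Y ^+ 2 != 0.
  apply: contraNneq wyh => D0; apply/eqP.
  have x0 := sqr_ge0 X; have y0 := sqr_ge0 Y.
  have {}x0 : X ^+ 2 = 0 by lra.
  have {}y0 : Y ^+ 2 = 0 by lra.
  by move/eqP: x0; move/eqP: y0; rewrite !sqrf_eq0 => /eqP -> /eqP ->.
split; apply: (mulIf D0); rewrite mul0r.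
  transitivity (X * (a * (w * w - y * y - 0 * 0 - h) + b * (2 * Y))
    + 2 * Y * (a * (2 * Y) + b * (y * y - w * w - 0 * 0 + h))); first by rewrite /X; ring.
  by rewrite e0 e1 !mulr0 !addr0.
transitivity (2 * Y * (a * (w * w - y * y - 0 * 0 - h) + b * (2 * Y))
    - X * (a * (2 * Y) + b * (y * y - w * w - 0 * 0 + h))); first by rewrite /X; ring.
by rewrite e0 e1 !mulr0 subr0.
Qed.

(** Where r 0 1 = 0, also z = 0; degeneracy needs w y = 0 and w^2 = y^2 + h, where y = r 0 0 + r 0
    2, which is impossible on the simplex. Where r 0 3 = 0, also h = 0, and n = (w, y, z) has no
    zero there. *)
Lemma knot_ball_mx r : std_simplex R 3 r -> r 0 1 = 0 \/ r 0 3%:R = 0 ->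
  knots (ellipse (ball_mx r)).
Proof.
move=> [rge0]; rewrite sum4E => rsum.
have := rge0 0; have := rge0 1; have := rge0 2%:R; have := rge0 3%:R => r3 r2 r1 r0.
case=> e.
  rewrite /ball_mx (_ : ball_z r = 0); last by rewrite /ball_z e mul0r.
  apply: knot_frame_z0; rewrite /ball_w /ball_y /ball_h e subr0; apply/eqP => -[e1 e2].
  have [y0|y0] := eqVneq (r 0 0 + r 0 2%:R) 0.
    have r00 : r 0 0 = 0 by lra.
    have r20 : r 0 2%:R = 0 by lra.
    by move: e2; rewrite r00 r20 !(mul0r, addr0); lra.
  have w0 : r 0 0 * r 0 2%:R = 0 by apply: (mulIf y0); rewrite mul0r.
  move: e2; rewrite w0 mul0r sub0r.
  have : 0 < (r 0 0 + r 0 2%:R) * (r 0 0 + r 0 2%:R) by rewrite -expr2 exprn_even_gt0.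
  lra.
rewrite /ball_mx (_ : ball_h r = 0); last by rewrite /ball_h e mulr0.
apply: knot_frame_h0; rewrite /ball_w /ball_y /ball_z; apply/eqP => -[e1 e2 e3].
have r12 : r 0 1 = 1 / 2 by lra.
have e4 : r 0 0 = r 0 2%:R by move: e3; rewrite r12; lra.
move: e1; rewrite e4 => /eqP; rewrite mulf_eq0 orbb => /eqP; lra.
Qed.

End ball.

(** * The boundary of the 3-simplex and its single intersection *)

Section ball_faces.
Variable R : realType.

(** For n = (0, 1, 0) this is the circle rotated by pi around the second axis. *)
Lemma unknot_frame0100 : unknots (ellipse (frame_mx 0 1 0 0 : 'M[R]_3)).
Proof.
suff -> : ellipse (frame_mx 0 1 0 0 : 'M[R]_3) =
    ellipse (rotation (vec3 (cos (pi / 2)) (sin (pi / 2)) 0) pi).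
  exact/rotation_unknot/pi_ge0.
apply: loop_ext => x; rewrite [RHS](@rotation_likeE _ (pi / 2) (cos pi) (sin pi)).
rewrite cospi sinpi cos_pihalf sin_pihalf cosBpihalf sinBpihalf ellipseE.
rewrite row0_frame row1_frame.
by apply: vec3P; rewrite !mxE /=; ring.
Qed.

(** Both faces are convex and contain the vertex (1, 0, 0, 0), whose ellipse is the preceding
    unknot; the segment from it to [r] is a path of knots. *)
Lemma unknot_ball_mx (r : 'rV[R]_4) : std_simplex R 3 r -> r 0 1 = 0 \/ r 0 3%:R = 0 ->
  unknots (ellipse (ball_mx r)).
Proof.
move=> rs rface.
pose line a : 'rV[R]_4 := (1 - a) *: vec4 1 0 0 0 + a *: r.
have lineE a i : line a 0 i = (1 - a) * vec4 1 0 0 0 0 i + a * r 0 i.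
  by rewrite !mxE.
have line0 : ball_mx (line 0) = frame_mx 0 1 0 0.
  by rewrite /ball_mx /ball_w /ball_y /ball_z /ball_h !lineE !vec4E; congr frame_mx; ring.
have line1 : line 1 = r by rewrite /line subrr scale0r add0r scale1r.
apply: (connected_component_trans unknot_frame0100); rewrite -line0 -line1.
apply: (@ellipse_path_component _ (fun a => ball_mx (line a))) => // [i j a|a /andP[a0 a1]].
  apply: (@continuous_comp _ _ _ line (fun r => ball_mx r i j)).
    apply: cvgD; apply: cvgZ; try exact: cvg_cst; last exact: cvg_id.
    by apply: cvgB; [exact: cvg_cst|exact: cvg_id].
  exact: (is_C1_continuous (ball_mx_C1 i j)).
have [r0 r1] := rs; apply: knot_ball_mx.
  split=> [i|].
    rewrite lineE addr_ge0 ?mulr_ge0 ?subr_ge0//.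
    by case: i => -[|[|[|[|//]]]] i; rewrite !mxE/=.
  under eq_bigr do rewrite lineE.
  rewrite big_split/= -!mulr_sumr r1 sum4E !vec4E; ring.
by case: rface => e; [left|right]; rewrite lineE !vec4E e !mulr0 addr0.
Qed.

Lemma ball_face13_unknot (i : 'I_4) : i = 1 \/ i = 3%:R ->
  simplex_in (@unknots R) (face i (ball3 R)).
Proof.
move=> i13 t; rewrite face_ellipse_simplex.
apply: unknot_ball_mx; first exact: set_mem (face_row_simplex i t).
by case: i13 => ->; [left|right]; exact: face_row_id.
Qed.

Lemma ball_face02 : face 0 (ball3 R) = face 2%:R (ball3 R).
Proof.
apply/continuousEP => t; rewrite !face_ellipse_simplex.
set r := face_row _ _; set r' := face_row _ _.
have r0 : r 0 0 = 0 by exact: face_row_id.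
have r1 : r 0 1 = \val t 0 0 by apply: face_rowE; exact/val_inj.
have r2 : r 0 2%:R = \val t 0 1 by apply: face_rowE; exact/val_inj.
have r3 : r 0 3%:R = \val t 0 2%:R by apply: face_rowE; exact/val_inj.
have r'0 : r' 0 0 = \val t 0 0 by apply: face_rowE; exact/val_inj.
have r'1 : r' 0 1 = \val t 0 1 by apply: face_rowE; exact/val_inj.
have r'2 : r' 0 2%:R = 0 by exact: face_row_id.
have r'3 : r' 0 3%:R = \val t 0 2%:R by apply: face_rowE; exact/val_inj.
congr ellipse.
have w0 : ball_w r = 0 by rewrite /ball_w r0 mul0r.
have w'0 : ball_w r' = 0 by rewrite /ball_w r'2 mulr0.
have yN : ball_y r = - ball_y r' by rewrite /ball_y r0 r1 r2 r'0 r'1 r'2; ring.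
have zN : ball_z r = - ball_z r' by rewrite /ball_z r0 r1 r2 r'0 r'1 r'2; ring.
have hE : ball_h r = ball_h r' by rewrite /ball_h r3 r'3.
by rewrite /ball_mx /frame_mx w0 w'0 yN zN hE !mulrNN !mul0r.
Qed.

Lemma boundary_ball3 :
  boundary << ball3 R >> = << face 1 (ball3 R) >> + << face 3%:R (ball3 R) >>.
Proof.
rewrite boundaryU sum4E ball_face02.
have cancel02 (a b d : chain R (loop R) 2) : a + b + a + d = b + d.
  by rewrite (addrC a) -(addrA b) chain_addcc addr0.
exact: cancel02.
Qed.

Definition ball_center_row : 'rV[R]_4 := vec4 (1 / 5) (2 / 5) (1 / 5) (1 / 5).

Lemma ball_center_subproof : ball_center_row \in std_simplex R 3.
Proof.
apply/mem_set; split; last by rewrite sum4E !vec4E; field.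
by case=> -[|[|[|[|//]]]] i; rewrite !mxE/=.
Qed.

Definition ball_center : std_simplex R 3 :=
  exist (fun t => t \in std_simplex R 3) _ ball_center_subproof.

(** If w = 0, then y^2 + z^2 + h = 0 with nonnegative terms, which the simplex excludes. Otherwise y
    = z = 0, so r = (x, 2 x, x, 1 - 4 x) and only w^2 = h remains. *)
Lemma row0_ball_mx_eq0 (r : 'rV[R]_4) : std_simplex R 3 r -> row 0 (ball_mx r) = 0 ->
  r = ball_center_row.
Proof.
move=> [rge0]; rewrite sum4E => rsum; rewrite row0_frame => /rowP e.
have := rge0 0; have := rge0 1; have := rge0 2%:R; have := rge0 3%:R => r3 r2 r1 r0.
have := e 0; have := e 1; have := e 2%:R; rewrite !vec3E !mxE => {e} e2 e1 e0.
have {}e1 : ball_w r * ball_y r = 0 by lra.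
have {}e2 : ball_w r * ball_z r = 0 by lra.
have [w0|w0] := eqVneq (ball_w r) 0.
  exfalso.
  have h0 : 0 <= ball_h r by rewrite mulr_ge0.
  have y2 := sqr_ge0 (ball_y r); have z2 := sqr_ge0 (ball_z r).
  rewrite w0 mul0r sub0r -!expr2 in e0.
  have /eqP : ball_y r ^+ 2 = 0 by lra.
  have /eqP : ball_z r ^+ 2 = 0 by lra.
  have {}h0 : ball_h r = 0 by lra.
  rewrite !sqrf_eq0 => /eqP z0 /eqP y0.
  move: w0 z0 y0 h0; rewrite /ball_w /ball_y /ball_z /ball_h => w0 z0 y0 h0.
  have r12 : r 0 1 = 1 / 2 by lra.
  have r02 : r 0 0 = r 0 2%:R by move: z0; rewrite r12; lra.
  by move: w0; rewrite r02 => /eqP; rewrite mulf_eq0 orbb => /eqP; lra.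
have y0 : ball_y r = 0 by apply: (mulfI w0); rewrite mulr0.
have z0 : ball_z r = 0 by apply: (mulfI w0); rewrite mulr0.
rewrite y0 z0 !mul0r !subr0 in e0.
move: w0 y0 z0 e0; rewrite /ball_w /ball_y /ball_z /ball_h => w0 y0 /eqP z0 e0.
have r02 : r 0 0 = r 0 2%:R.
  move: z0; rewrite mulf_eq0 subr_eq0 => /orP[/eqP r10|/eqP//].
  by have := r0; have := r2; lra.
set x := r 0 2%:R in r02 r2 rsum y0 e0 *.
have r1E : r 0 1 = 2 * x by lra.
have r3E : r 0 3%:R = 1 - 4 * x by lra.
(* This is 125 x^4 + 4 x - 1; the cubic factor is positive for x >= 0. *)
have /eqP : (5 * x - 1) * (25 * x ^+ 3 + 5 * x ^+ 2 + x + 1) = 0.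
  transitivity (125 * (x * x * (x * x) - 125%:R^-1 * (1 - 4 * x))); first by field.
  by rewrite -r3E -{1 3}r02 e0 mulr0.
have x2 := sqr_ge0 x; have x3 : 0 <= x ^+ 3 by rewrite exprn_ge0.
rewrite mulf_eq0 => /orP[/eqP x5|/eqP x5]; last by exfalso; lra.
by apply: vec4P; rewrite -/x; lra.
Qed.

Lemma row0_ball_center : row 0 (ball_mx ball_center_row) = 0.
Proof.
rewrite row0_frame /ball_w /ball_y /ball_z /ball_h !vec4E.
by apply/esym/vec3P; rewrite !mxE; field.
Qed.

Lemma ball_base_antipodal t : base_antipodal_variety (ball3 R t) <-> t = ball_center.
Proof.
have := ellipse_simplex_antipodal (@ball_mx_C1 R) t 0; rewrite add0r => base.
apply: (iff_trans base); rewrite ellipseE cos0 sin0 scale1r scale0r addr0.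
split=> [t0|->]; last exact: row0_ball_center.
by apply: val_inj; apply: row0_ball_mx_eq0 => //; exact: set_mem (valP t).
Qed.

Lemma row0_dframe (w y z dw dy dz dh : R) : row 0 (frame_dmx w y z dw dy dz dh) =
  vec3 (2 * (w * dw) - 2 * (y * dy) - 2 * (z * dz) - dh)
    (2 * (w * dy + y * dw)) (2 * (w * dz + z * dw)).
Proof. by apply/rowP => j; rewrite !mxE /= ?mxE. Qed.

Lemma ball_transverse : base_antipodal_transverse (ball3 R) ball_center.
Proof.
apply: ellipse_base_antipodal_transverse => W.
(* At the centre w = 1/25 and y = z = 0. With P = v_0 + v_2, Q = v_0 - v_2 and v_3 = - P - v_1, the
   differential of row 0 is ((3 P + v_1) / 125, 2 (P - v_1) / 25, 4 Q / 125); the witnesses solve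
   this system for W. *)
pose P := 125 / 4 * (W 0 0 + W 0 1 / 10).
pose Q := 125 / 4 * W 0 2%:R.
pose v1 := P - 25 / 2 * W 0 1.
exists (vec4 ((P + Q) / 2) v1 ((P - Q) / 2) (- P - v1)); split.
  by rewrite /tangent sum4E !vec4E; field.
rewrite [RHS](@vec3P _ W _ _ _ erefl erefl erefl).
rewrite row0_dframe /ball_w /ball_y /ball_z /ball_dw /ball_dy /ball_dz /ball_dh.
by rewrite !vec4E /v1 /P /Q; congr vec3; field.
Qed.

Lemma ball_boundary_linking (l : cochain R (loop R) 2) :
  is_linking_class (@base_antipodal_variety R) (@base_antipodal_transverse R) l ->
  eval l (boundary << ball3 R >>) = 1.
Proof.
move=> [_ ll].
have [gen int1] : generic_chain (@base_antipodal_variety R)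
      (@base_antipodal_transverse R) << ball3 R >>
    /\ intersection_number (@base_antipodal_variety R) << ball3 R >> = 1.
  apply: single_intersection ball_base_antipodal _ ball_transverse => i.
  by case: i => -[|[|[|[|//]]]] i; rewrite !mxE/=.
rewrite (ll _ _ _ erefl gen)//; split; last exact: boundary_boundary.
move=> s; rewrite boundary_ball3 => /domD_subset; rewrite mem_cat !domU1 !inE.
by move=> /orP[] /eqP -> t; apply: connected_component_sub;
  apply: ball_face13_unknot; [left|right].
Qed.

End ball_faces.

(** * Non-triviality on the component of unknots *)

Theorem mainTheorem4 (R : realType)
    (l1 : cochain R (loop R) 1) (l2 : cochain R (loop R) 2)
    (hl1 : is_linking_class (@antipodal_variety R)
             (@antipodal_transverse R) l1)
    (hl2 : is_linking_class (@base_antipodal_variety R)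
             (@base_antipodal_transverse R) l2) :
  [/\ ~ coboundary_on (@unknots R) l1,
      ~ coboundary_on (@unknots R) l2 &
      forall theta : R,
        cycle_in (@unknots R) (<< rotating_circle theta >> : chain R (loop R) 1)
        /\ eval l1 << rotating_circle theta >> <> 0].
Proof.
split=> [[g gl]|[g gl]|theta].
(* A coboundary on the unknots vanishes on cycles of unknots; the diameter theta = 0 is enough
   here. *)
- have := rotating_circle_linking 0 hl1.
  rewrite evalU gl; last exact: rotating_circle_unknot.
  by rewrite boundary_rotating_circle eval0 => /eqP; rewrite eq_sym oner_eq0.
- have := ball_boundary_linking hl2.
  (* The coboundary formula holds only on simplices of unknots, so it is applied to the two
     remaining faces, which are then regrouped into the boundary of a boundary. *)
  rewrite boundary_ball3 evalD !evalU !gl; try by apply: ball_face13_unknot; by [left|right].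
  rewrite -evalD -boundaryD -boundary_ball3 boundary_boundary eval0.
  by move=> /eqP; rewrite eq_sym oner_eq0.
- split; first exact: rotating_circle_cycle.
  by rewrite rotating_circle_linking//; apply/eqP; rewrite oner_eq0.
Qed.
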